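(* Let $G$ be the simply connected simple complex algebraic group of type $G_2$ and let $H\subset G$ be the subsystem subgroup of type $A_2$ whose roots are the long roots of $G$. Then the varieties $G/P_1$ and $G/P_2$ are $H$-spherical.
   Context: The ground field is $\mathbb{C}$. Fix a maximal torus $T$ and a Borel subgroup $B\supset T$ of $G$, with simple roots $\alpha_1,\alpha_2$ and fundamental weights $\omega_1,\omega_2$ in Bourbaki numbering ($\alpha_1$ short, $\alpha_2$ long). $P_i\supset B$ is the maximal parabolic subgroup of $G$ associated to $\omega_i$ (the stabilizer of the highest weight line in the irreducible $G$-module of highest weight $\omega_i$; $P_i$ is generated by $B$ and the root subgroups $U_{-\alpha_j}$, $j\neq i$). The subgroup $H$ contains $T$ and has simple roots $3\alpha_1+\alpha_2$ and $\alpha_2$. $H$ acts on $G/P_i$ by left multiplication. $G/P_i$ is called $H$-spherical (a spherical $H$-variety) if a Borel subgroup of $H$ has an open orbit in it. *)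

(* Defs.v *)
From mathcomp Require Import all_boot all_order all_algebra.
From mathcomp Require Import mpoly.
From mathcomp Require Import classical_sets.

Set Implicit Arguments.
Unset Strict Implicit.
Unset Printing Implicit Defensive.

Import GRing.Theory.

Local Open Scope classical_set_scope.
Local Open Scope ring_scope.

Section LinearAlgebraicGroups.
Variables (F : fieldType) (n : nat).
Local Notation M := 'M[F]_n.+1.
Implicit Types (A B G H K P U : set M) (g x : M).

Definition zero_locus (S : set {mpoly F[n.+1 * n.+1]}) : set M :=
  [set g | forall p, S p -> p.@[fun k => mxvec g 0 k] = 0].

(* Subsets of GL_{n+1}(F) carry the topology induced from the affine space of
   matrices; on GL_{n+1}(F) itself this is the Zariski topology, since inverting
   the determinant does not create new closed sets. *)
Definition zclosed_in A B : Prop :=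
  B `<=` A /\ exists S, B = A `&` zero_locus S.

Definition zopen_in A B : Prop := B `<=` A /\ zclosed_in A (A `\` B).

Definition zconnected A : Prop :=
  forall B, zclosed_in A B -> zopen_in A B -> B = set0 \/ B = A.

Definition is_subgroup G : Prop :=
  [/\ G `<=` [set g | g \is a GRing.unit], G 1,
      forall g x, G g -> G x -> G (g * x) & forall g, G g -> G g^-1].

(* Meant for sets S of invertible matrices only. *)
Definition generated (S : set M) : set M := smallest is_subgroup S.

Definition derived G : set M :=
  generated [set y | exists g x, [/\ G g, G x & y = g^-1 * x^-1 * g * x]].

Definition solvable_group G : Prop := exists k, iter k derived G = [set 1].

Definition connected_solvable_in H B : Prop :=
  [/\ is_subgroup B, zclosed_in H B, zconnected B & solvable_group B].

Definition Borel_subgroup H B : Prop :=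
  connected_solvable_in H B /\
  forall K, connected_solvable_in H K -> B `<=` K -> K = B.

Definition translate g A : set M := [set g * x | x in A].

Definition cosets G P : set (set M) := [set translate g P | g in G].

(* The projection G -> G/P is a topological quotient map for the Zariski
   topologies, so this is the Zariski topology of the variety G/P. *)
Definition open_in_cosets G P (O : set (set M)) : Prop :=
  O `<=` cosets G P /\ zopen_in G [set g | G g /\ O (translate g P)].

Definition coset_orbit K (X : set M) : set (set M) :=
  [set translate b X | b in K].

(* G/P is a spherical H-variety, H acting by left multiplication. *)
Definition spherical G P H : Prop :=
  exists B, Borel_subgroup H B /\
  exists X, cosets G P X /\ open_in_cosets G P (coset_orbit B X).

End LinearAlgebraicGroups.

(* Positive roots; Rab stands for a * alpha_1 + b * alpha_2, with alpha_1 short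
   and alpha_2 long. A root is a pair of a sign (true for positive) and a
   positive root. *)
Variant posroot := R10 | R01 | R11 | R21 | R31 | R32.

Definition is_long (r : posroot) : bool :=
  match r with R01 | R31 | R32 => true | R10 | R11 | R21 => false end.

(* G_2 as a Chevalley group. The simply connected group of type G_2 acts
   faithfully on its 7-dimensional irreducible module, of highest weight
   omega_1 = 2 alpha_1 + alpha_2, whose weights are, in the order of the basis
   used here,
     2a1+a2, a1+a2, a1, 0, -a1, -a1-a2, -2a1-a2. *)
Section G2.
Variable F : fieldType.
Local Notation M := 'M[F]_7.

(* Matrix unit, with rows and columns numbered from 1 to 7. *)
Definition E (i j : nat) : M := delta_mx (inord i.-1) (inord j.-1).

(* Chevalley generators of the Lie algebra: e_i has weight alpha_i and f_i has
   weight - alpha_i. *)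
Definition e1 : M := E 1 2 + 2 *: E 3 4 + E 4 5 + E 6 7.
Definition e2 : M := E 2 3 + E 5 6.
Definition f1 : M := E 2 1 + E 4 3 + 2 *: E 5 4 + E 7 6.
Definition f2 : M := E 3 2 + E 6 5.

Definition bracket (x y : M) : M := x * y - y * x.

(* Spans the root space of the root (s, r) in the Lie algebra. *)
Definition root_vector (s : bool) (r : posroot) : M :=
  let x1 := if s then e1 else f1 in
  let x2 := if s then e2 else f2 in
  let x11 := bracket x1 x2 in
  let x21 := bracket x1 x11 in
  let x31 := bracket x1 x21 in
  match r with
  | R10 => x1 | R01 => x2 | R11 => x11 | R21 => x21 | R31 => x31
  | R32 => bracket x2 x31
  end.

(* Exponential of a nilpotent 7 x 7 matrix, in characteristic 0. *)
Definition exp_nilp (x : M) : M := \sum_(k < 7) (k`!)%:R^-1 *: x ^+ k.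

Definition root_subgroup (s : bool) (r : posroot) : set M :=
  [set exp_nilp (c *: root_vector s r) | c in [set: F]].

(* The value at (c, d) of the product of the simple coroots, which form a basis
   of the cocharacter lattice: the coroots of alpha_1 and alpha_2 take the
   values 1, -1, 2, 0, -2, 1, -1 and 0, 1, -1, 0, 1, -1, 0 on the weights. *)
Definition torus_elt (c d : F) : M :=
  diag_mx (\row_j [:: c; d / c; c ^+ 2 / d; 1; d / c ^+ 2; c / d; c^-1]`_j).

Definition torus : set M :=
  [set t | exists c d, [/\ c != 0, d != 0 & t = torus_elt c d]].

Definition G2 : set M := generated (torus `|` \bigcup_s \bigcup_r root_subgroup s r).

Definition std_borel : set M := generated (torus `|` \bigcup_r root_subgroup true r).

(* Maximal parabolic subgroups associated to omega_1 and omega_2. *)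
Definition P1 : set M := generated (std_borel `|` root_subgroup false R01).
Definition P2 : set M := generated (std_borel `|` root_subgroup false R10).

(* Subsystem subgroup of type A_2. *)
Definition A2_long : set M :=
  generated (torus `|` \bigcup_s \bigcup_(r in [set r | is_long r]) root_subgroup s r).

End G2.

Arguments G2 F : clear implicits.
Arguments std_borel F : clear implicits.
Arguments P1 F : clear implicits.
Arguments P2 F : clear implicits.
Arguments A2_long F : clear implicits.

(* Main.v *)
From HB Require Import structures.
Require Import Defs.
From mathcomp Require Import all_boot all_order all_algebra.
From mathcomp Require Import reals complex mpoly boolp classical_sets ring.

(* The root vectors are derivations of the alternating product of the imaginary
   octonions and are skew for its quadratic form, so every group at hand acts by
   automorphisms of both. Elimination by root subgroups shows that an automorphism
   stabilizing the line <e_0>, resp. the plane <e_0, e_1>, lies in P_1, resp. P_2.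

   The subgroup H respects the splitting 7 = 3 + 3^* + 1 of the module. Its upper
   triangular elements form the Borel subgroup B = T U: a solvable overgroup of B in
   H is upper triangular because its projection to GL_3 is a solvable group
   containing all upper unitriangular matrices. An element of B acts on the
   coordinates 3, 5 and 6 by scalars, so the nonvanishing of these coordinates of
   g e_0 (case of P_1), resp. of the Pluecker coordinates of <g e_0, g e_1> they
   define (case of P_2), is invariant under B. On this open set, B brings the line,
   resp. the plane, to a normal form in which the remaining coordinates are
   determined by the octonion product and the quadratic form; hence the open set
   is a single B-orbit. *)

Set Implicit Arguments.
Unset Strict Implicit.
Unset Printing Implicit Defensive.

Import GRing.Theory Num.Theory.

Local Open Scope classical_set_scope.
Local Open Scope ring_scope.

(** * Subgroups and homomorphisms *)

(** The group B has dimension 5, two for the torus and one for each of the three positive long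
    roots, and G/P_1 and G/P_2 both have dimension 5. Stabilizers in an open orbit are therefore
    finite and every parameter of B is spent on the normal form: the torus, helped by a rescaling
    inside P_i, makes the pivots equal to 1, and each long root element clears one more entry.
    Nothing remains to adjust the other coordinates, which is why the product and the form must
    determine them.

    The groups are given by generators. All that is visible of their elements are conditions
    inherited by products and inverses: the octonion equations, the stability of a flag, the
    splitting into summands. Conversely, membership in P_1 or P_2 has to come out of an explicit
    factorization.

    The summands under H are spanned by e_0, e_4, e_5, by e_1, e_2, e_6 and by e_3. The coordinates
    5, 6 and 3 are the last ones in each, which makes them semi-invariant under B. A solvable
    overgroup of B does not contain all unitriangular 7 x 7 matrices; its image on the first summand
    does contain all 3 x 3 ones, and there the argument for full matrix groups applies. *)

Section Subgroups.
Variables (F : fieldType) (n : nat).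
Local Notation M := 'M[F]_n.+1.
Implicit Types (A G K P S : set M) (g h x y : M).

Lemma subgroup_unit G g : is_subgroup G -> G g -> g \is a GRing.unit.
Proof. by case=> uG _ _ _; apply: uG. Qed.

(** The shape of the eliminations below: membership of [h] is reduced to that of [x * h], with [x]
    an element of [G] chosen to clear an entry. *)
Lemma subgroup_mulKl G x h : is_subgroup G -> G x -> G (x * h) -> G h.
Proof.
move=> sG Gx Gxh; have ux := subgroup_unit sG Gx.
by case: sG => _ _ GM GV; rewrite -(mulKr ux h); apply: GM => //; apply: GV.
Qed.

Lemma units_subgroup : is_subgroup [set g : M | g \is a GRing.unit].
Proof.
split=> [g //||g x /= ug ux|g /= ug]; rewrite /= ?unitr1 //.
  by rewrite unitrMl.
by rewrite unitrV.
Qed.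

Lemma generated_sub S G : is_subgroup G -> S `<=` G -> generated S `<=` G.
Proof. by move=> sG SG g; apply. Qed.

Lemma sub_generated S : S `<=` generated S.
Proof. by move=> g Sg G [_]; apply. Qed.

Lemma generated_subgroup S :
  S `<=` [set g | g \is a GRing.unit] -> is_subgroup (generated S).
Proof.
move=> uS; split.
- by apply: generated_sub => //; exact: units_subgroup.
- by move=> G [[]].
- move=> g x Sg Sx G sG; have [[_ _ GM _] _] := sG.
  by apply: GM; [apply: Sg | apply: Sx].
- by move=> g Sg G sG; have [[_ _ _ GV] _] := sG; apply: GV; apply: Sg.
Qed.

Lemma derived_subset G A : is_subgroup A -> G `<=` A -> derived G `<=` A.
Proof.
move=> sA GA; apply: generated_sub => // y [g [x [/GA Ag /GA Ax ->]]].
by case: sA => _ _ AM AV; (do 3?apply: (AM)) => //; apply: AV.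
Qed.

Lemma derived_subgroup G : is_subgroup G -> is_subgroup (derived G).
Proof.
move=> [uG _ _ _]; apply: generated_subgroup => y [g [x [/uG ug /uG ux ->]]].
by rewrite /= !unitrMl ?unitrV.
Qed.

Lemma iter_derived_subgroup k G :
  is_subgroup G -> is_subgroup (iter k (@derived F n) G).
Proof. by move=> sG; elim: k => //= k; apply: derived_subgroup. Qed.

Lemma iter_derived_subset k G : is_subgroup G -> iter k (@derived F n) G `<=` G.
Proof.
move=> sG; elim: k => //= k IH; apply: derived_subset => //.
Qed.

Lemma commutator_derived G g x :
  G g -> G x -> derived G (g^-1 * x^-1 * g * x).
Proof. by move=> Gg Gx; apply: sub_generated; exists g, x. Qed.

Lemma solvableS G : is_subgroup G ->
  (exists k, iter k (@derived F n) G `<=` [set 1]) -> solvable_group G.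
Proof.
move=> sG [k kG]; exists k; apply/seteqP; split=> // _ ->.
by case: (iter_derived_subgroup k sG).
Qed.

Lemma translateM g x P : translate g (translate x P) = translate (g * x) P.
Proof.
apply/seteqP; split=> [_ [_ [y Py <-] <-]|_ [y Py <-]].
  by exists y => //; rewrite mulrA.
by exists (x * y); [exists y | rewrite mulrA].
Qed.

Lemma eq_translate g x P : is_subgroup P -> x \is a GRing.unit ->
  translate g P = translate x P <-> exists2 y, P y & g = x * y.
Proof.
move=> [uP P1 PM PV] ux; split=> [eqP|[y Py ->]].
  have: translate g P g by exists 1; rewrite ?mulr1.
  by rewrite eqP => -[y Py <-]; exists y.
rewrite -translateM; congr translate; apply/seteqP; split=> [_ [z Pz <-]|z Pz].
  exact: PM.
by exists (y^-1 * z); [apply: PM => //; apply: PV | rewrite mulVKr ?uP].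
Qed.

End Subgroups.

Section Homomorphisms.
Variables (F : fieldType) (m n : nat) (K : set 'M[F]_m.+1).
Variable phi : 'M[F]_m.+1 -> 'M[F]_n.+1.
Hypothesis sK : is_subgroup K.
Hypothesis phi1 : phi 1 = 1.
(** Multiplicativity is asked on [K] alone: the map of interest extracts a 3 x 3 block, which
    respects products only of matrices preserving the splitting of the module. *)
Hypothesis phiM : forall g h, K g -> K h -> phi (g * h) = phi g * phi h.

Lemma morph_unit g : K g -> phi g \is a GRing.unit /\ phi g^-1 = (phi g)^-1.
Proof.
move=> Kg; have ug := subgroup_unit sK Kg; case: sK => _ _ _ KV.
have e1 : phi g * phi g^-1 = 1 by rewrite -phiM ?divrr //; apply: KV.
have e2 : phi g^-1 * phi g = 1 by rewrite -phiM ?mulVr //; apply: KV.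
have u : phi g \is a GRing.unit by apply/unitrP; exists (phi g^-1).
by split=> //; rewrite -[LHS](mulKr u) e1 mulr1.
Qed.

Lemma morph_subgroup A : is_subgroup A -> A `<=` K -> is_subgroup (phi @` A).
Proof.
move=> [_ A1 AM AV] AK; split.
- by move=> _ [g /AK/morph_unit[ug _] <-].
- by exists 1.
- move=> _ _ [g Ag <-] [h Ah <-]; exists (g * h); first exact: AM.
  by apply: phiM; apply: AK.
- move=> _ [g Ag <-]; exists g^-1; first exact: AV.
  by have [] := morph_unit (AK _ Ag).
Qed.

Lemma morph_solvable : solvable_group K -> solvable_group (phi @` K).
Proof.
move=> [k kK]; apply: solvableS; first exact: morph_subgroup.
exists k; suff: iter k (@derived F n) (phi @` K) `<=` phi @` iter k (@derived F m) K.
  by rewrite kK => /subset_trans; apply => _ [_ -> <-] /=.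
elim: k {kK} => //= k IH.
have sk := iter_derived_subgroup k sK; have kK := iter_derived_subset (k := k) sK.
apply: generated_sub.
  by apply: morph_subgroup; [exact: derived_subgroup | apply: derived_subset].
move=> _ [_ [_ [/IH[g Ag <-] /IH[x Ax <-] ->]]].
exists (g^-1 * x^-1 * g * x); first exact: commutator_derived.
have [_ _ KM KV] := sK.
have [Kg Kx] : K g /\ K x by split; apply: kK.
have [[_ Vg] [_ Vx]] := (morph_unit Kg, morph_unit Kx).
have [Kg' Kx'] := (KV _ Kg, KV _ Kx); have Kgx := KM _ _ Kg' Kx'.
by rewrite !phiM ?Vg ?Vx //; apply: KM.
Qed.

End Homomorphisms.

(** * Zariski topology *)

Section Regularity.
Variables (F : numFieldType) (n : nat).
Local Notation M := 'M[F]_n.+1.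
Implicit Types (A : set M) (p : {mpoly F[n.+1 * n.+1]}) (q P : {poly F}).

Definition mxeval p (g : M) : F := p.@[fun k => mxvec g 0 k].

Definition entry_poly (i j : 'I_n.+1) : {mpoly F[n.+1 * n.+1]} :=
  'X_(mxvec_index i j).

Lemma mxeval_entry i j (g : M) : mxeval (entry_poly i j) g = g i j.
Proof. by rewrite /mxeval mevalXU mxvecE. Qed.

(** The preimage in [G] of the [B]-orbit of [g0 P] is the double coset [B g0 P]. By the last
    hypothesis its complement in [G] is the zero locus of the single polynomial [p]. *)
Lemma spherical_criterion (G P H B : set M) g0 p :
    is_subgroup G -> is_subgroup P -> Borel_subgroup H B -> B `<=` G -> G g0 ->
    (forall g, G g -> mxeval p g != 0 <->
       exists b x, [/\ B b, P x & g = b * g0 * x]) ->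
  spherical G P H.
Proof.
move=> sG sP bB BG Gg0 openE.
have [_ _ GM _] := sG.
have [[sB _ _ _] _] := bB.
exists B; split=> //; exists (translate g0 P); split; first by exists g0.
have orbitE g : G g -> coset_orbit B (translate g0 P) (translate g P) <->
    mxeval p g != 0.
  move=> Gg; rewrite openE //.
  have ub b : B b -> b * g0 \is a GRing.unit.
    by move=> Bb; apply: subgroup_unit sG _; apply: GM => //; apply: BG.
  split.
    move=> [b Bb]; rewrite translateM => /esym bg.
    have [/(_ bg)[x Px ->] _] := eq_translate g sP (ub _ Bb).
    by exists b, x.
  move=> [b [x [Bb Px gE]]]; exists b => //; rewrite translateM.
  apply/esym; have [_ ->] := eq_translate g sP (ub _ Bb); first by [].
  by exists x.
split.
  move=> _ [b Bb <-]; exists (b * g0); last by rewrite translateM.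
  by apply: GM => //; apply: BG.
split; first by move=> g [].
split; first by move=> g [].
exists [set p]; apply/seteqP; split=> [g [Gg notO]|g [Gg pg]]; split=> //.
  move=> _ ->; apply/eqP; case: eqP => // /eqP pg.
  by exfalso; apply: notO; split=> //; apply/orbitE.
by move=> [_ /(orbitE g Gg)]; rewrite /mxeval pg ?eqxx.
Qed.

Lemma poly_eq0_horner q : (forall t, q.[t] = 0) -> q = 0.
Proof.
move=> q0; apply/eqP/negP => /negP qN0.
pose rs : seq F := [seq i%:R | i <- iota 0 (size q)].
have rootrs : all (root q) rs.
  by apply/allP => _ /mapP[i _ ->]; rewrite rootE q0.
have uniqrs : uniq rs.
  by rewrite map_inj_uniq ?iota_uniq // => i j /eqP; rewrite eqr_nat => /eqP.
by have := max_poly_roots qN0 rootrs uniqrs; rewrite size_map size_iota ltnn.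
Qed.

(** Regular functions on the principal open set where [q] does not vanish, that is, fractions
    [P / q ^+ N]. With the denominator cleared, the values of [f] at the zeros of [q] are left
    free. *)
Definition regular_off q (f : F -> F) : Prop :=
  exists N P, forall t, q.[t] != 0 -> q.[t] ^+ N * f t = P.[t].

Lemma regular_off_horner q r : regular_off q (horner r).
Proof. by exists 0%N, r => t _; rewrite mul1r. Qed.

Lemma regular_off_cst q c : regular_off q (fun=> c).
Proof. by exists 0%N, c%:P => t _; rewrite mul1r hornerC. Qed.

Lemma regular_offD q f g :
  regular_off q f -> regular_off q g -> regular_off q (fun t => f t + g t).
Proof.
move=> [N [P fP]] [N' [P' gP]]; exists (N + N')%N, (q ^+ N' * P + q ^+ N * P').
move=> t qt; rewrite ?(hornerD, hornerM, horner_exp) -fP // -gP // exprD; ring.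
Qed.

Lemma regular_offM q f g :
  regular_off q f -> regular_off q g -> regular_off q (fun t => f t * g t).
Proof.
move=> [N [P fP]] [N' [P' gP]]; exists (N + N')%N, (P * P').
move=> t qt; rewrite ?(hornerD, hornerM, horner_exp) -fP // -gP // exprD; ring.
Qed.

Lemma regular_off_sum q (I : Type) (r : seq I) (f : I -> F -> F) :
  (forall i, regular_off q (f i)) -> regular_off q (fun t => \sum_(i <- r) f i t).
Proof.
move=> rf; elim: r => [|i r [N [P fP]]].
  by exists 0%N, 0 => t _; rewrite big_nil mulr0 horner0.
have [N' [P' gP]] := regular_offD (rf i) (ex_intro _ N (ex_intro _ P fP)).
by exists N', P' => t qt; rewrite big_cons gP.
Qed.

Lemma regular_off_prod q (I : Type) (r : seq I) (f : I -> F -> F) :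
  (forall i, regular_off q (f i)) -> regular_off q (fun t => \prod_(i <- r) f i t).
Proof.
move=> rf; elim: r => [|i r [N [P fP]]].
  by exists 0%N, 1 => t _; rewrite big_nil mulr1 hornerE.
have [N' [P' gP]] := regular_offM (rf i) (ex_intro _ N (ex_intro _ P fP)).
by exists N', P' => t qt; rewrite big_cons gP.
Qed.

Definition regular_curve q (f : F -> M) : Prop :=
  forall i j, regular_off q (fun t => f t i j).

Lemma regular_curveM q f g :
  regular_curve q f -> regular_curve q g -> regular_curve q (fun t => f t * g t).
Proof.
move=> rf rg i j.
have [N [P fP]] := regular_off_sum (index_enum 'I_n.+1)
  (fun k => regular_offM (rf i k) (rg k j)).
by exists N, P => t qt; rewrite mxE fP.
Qed.

Lemma regular_off_mxeval q f p :
  regular_curve q f -> regular_off q (fun t => mxeval p (f t)).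
Proof.
move=> rf.
have rX k e : regular_off q (fun t => mxvec (f t) 0 k ^+ e).
  elim: e => [|e IH].
    by exists 0%N, 1 => t _; rewrite !expr0 mulr1 hornerC.
  have rk : regular_off q (fun t => mxvec (f t) 0 k).
    case/mxvec_indexP: k {IH} => i j; have [N [P fP]] := rf i j.
    by exists N, P => t qt; rewrite mxvecE fP.
  have [N [P fP]] := regular_offM rk IH.
  by exists N, P => t qt; rewrite exprS fP.
have [N [P fP]] := regular_off_sum (msupp p) (fun m =>
  regular_offM (regular_off_cst q p@_m)
    (regular_off_prod (index_enum _) (fun k => rX k (m k)))).
by exists N, P => t qt; rewrite -fP // /mxeval mevalE.
Qed.

Lemma zconnected_curve A :
    (forall x y, A x -> A y -> exists q f,
      [/\ q.[0] != 0, q.[1] != 0, regular_curve q f, f 0 = x /\ f 1 = y &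
          forall t, q.[t] != 0 -> A (f t)]) ->
  zconnected A.
Proof.
(* If [B] is clopen with [x] in [B] and [y] outside, then along a curve from [x] to
   [y] a polynomial vanishing on [B] times one vanishing outside [B] is zero. *)
move=> curve B [BA [S BE]] [_ [_ [S' CE]]].
have [->|/set0P[x Bx]] := eqVneq B set0; [by left | right].
apply/seteqP; split=> // y Ay; apply: contrapT => nBy.
have Ax := BA _ Bx.
have [q [f [q0 q1 rf [f0 f1] Af]]] := curve x y Ax Ay.
have [s Ss sy] : exists2 s, S s & mxeval s y != 0.
  apply: contrapT => nS; apply: nBy; rewrite BE; split=> // s Ss.
  by apply/eqP/negP => /negP sy; apply: nS; exists s.
have [s' Ss' sx] : exists2 s, S' s & mxeval s x != 0.
  apply: contrapT => nS; have : (A `\` B) x; last by case.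
  rewrite CE; split=> // s' Ss'.
  by apply/eqP/negP => /negP sx; apply: nS; exists s'.
have [N [P fP]] := regular_off_mxeval s rf.
have [N' [P' fP']] := regular_off_mxeval s' rf.
(* The factor [q] takes care of the parameters at which nothing is known about the curve, so that
   the product vanishes at every [t]. *)
have P0 : P * P' * q = 0.
  apply: poly_eq0_horner => t; rewrite !hornerE.
  have [->|qt] := eqVneq q.[t] 0; first by rewrite mulr0.
  rewrite -fP // -fP' //; have [Bt|nBt] := pselect (B (f t)).
    have -> : mxeval s (f t) = 0 by move: Bt; rewrite BE => -[_]; apply.
    by rewrite mulr0 !mul0r.
  have -> : mxeval s' (f t) = 0.
    have : (A `\` B) (f t) by split=> //; apply: Af.
    by rewrite CE => -[_]; apply.
  by rewrite mulr0 mulr0 mul0r.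
have P1 : P.[1] != 0 by rewrite -fP // f1 mulf_neq0 ?expf_neq0.
have P'0 : P'.[0] != 0 by rewrite -fP' // f0 mulf_neq0 ?expf_neq0.
have PN0 : P != 0 by apply: contraNneq P1 => ->; rewrite horner0.
have P'N0 : P' != 0 by apply: contraNneq P'0 => ->; rewrite horner0.
have qN0 : q != 0 by apply: contraNneq q0 => ->; rewrite horner0.
by move/eqP: P0; rewrite !mulf_eq0 (negPf PN0) (negPf P'N0) (negPf qN0).
Qed.

End Regularity.

(** * Solvable groups and triangular matrices *)

Section Triangular.
Variables (F : numFieldType) (n : nat).
Local Notation M := 'M[F]_n.+1.
Implicit Types (A B g h x y : M) (G K : set M) (k l : nat).

(** [band 0] is upper triangular, [band 1] strictly upper triangular; in general the k-th step of
    the filtration of matrices by distance above the diagonal. *)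
Definition band k A : Prop := forall i j : 'I_n.+1, (j < k + i)%N -> A i j = 0.

Lemma bandM k l A B : band k A -> band l B -> band (k + l) (A * B).
Proof.
move=> kA lB i j jkl; rewrite mxE big1 // => m _.
have [mki|kim] := ltnP m (k + i); first by rewrite kA ?mul0r.
rewrite lB ?mulr0 // (leq_trans jkl) // addnAC addnC.
by rewrite leq_add2l.
Qed.

Lemma bandD k A B : band k A -> band k B -> band k (A + B).
Proof. by move=> kA kB i j ij; rewrite mxE kA ?kB ?addr0. Qed.

Lemma bandN k A : band k A -> band k (- A).
Proof. by move=> kA i j ij; rewrite mxE kA ?oppr0. Qed.

Lemma band_leq k l A : (k <= l)%N -> band l A -> band k A.
Proof. by move=> kl lA i j ij; apply: lA; rewrite (leq_trans ij) ?leq_add2r. Qed.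

Lemma band1 : band 0 (1 : M).
Proof. by move=> i j ij; rewrite mxE -val_eqE gtn_eqF. Qed.

(** For positive [k] both products already lie in [band (k + k)]. For [k = 0] the gain comes from
    the diagonals of [A * B] and [B * A], which agree. *)
Lemma band_commutator k A B : band k A -> band k B -> band k.+1 (A * B - B * A).
Proof.
case: k => [|k] kA kB; last first.
  apply: (@band_leq _ (k.+1 + k.+1)); first by rewrite addSn ltnS leq_addl.
  by apply: bandD; [|apply: bandN]; apply: bandM.
move=> i j; rewrite add1n ltnS leq_eqVlt => /orP[/eqP/val_inj ->|ij]; last first.
  have AB0 : band 0 (A * B - B * A).
    by apply: bandD; [|apply: bandN]; apply: (@bandM 0 0).
  exact: AB0.
have diagM X Y : band 0 X -> band 0 Y -> (X * Y) i i = X i i * Y i i.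
  move=> X0 Y0; rewrite mxE (bigD1 i) //= big1 ?addr0 // => m mi.
  have [mlt|] := ltnP m i; first by rewrite X0 ?mul0r.
  by rewrite leq_eqVlt val_eqE eq_sym (negPf mi) => im; rewrite Y0 ?mulr0.
have -> : (A * B - B * A) i i = (A * B) i i - (B * A) i i by rewrite !mxE.
by rewrite !diagM // mulrC subrr.
Qed.

Lemma band_subgroup G k : is_subgroup G -> (forall g, G g -> band 0 g) ->
  is_subgroup [set g | G g /\ band k (g - 1)].
Proof.
move=> [uG G1 GM GV] G0; split.
- by move=> g [/uG].
- by split=> // i j _; rewrite subrr mxE.
- move=> g x [Gg kg] [Gx kx]; split; first exact: GM.
  have -> : g * x - 1 = (g - 1) * x + (x - 1) by rewrite mulrBl mul1r addrA subrK.
  by apply: bandD => //; rewrite -[k]addn0; apply: bandM => //; apply: G0.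
- move=> g [Gg kg]; split; first exact: GV.
  have -> : g^-1 - 1 = - ((g - 1) * g^-1).
    by rewrite mulrBl mul1r divrr ?uG // opprB.
  by apply: bandN; rewrite -[k]addn0; apply: bandM => //; apply/G0/GV.
Qed.

(** A group commutator minus 1 is a unit of [G] times the additive commutator of [g - 1] and
    [x - 1], so each derived subgroup moves one step up the filtration. After [n.+1] steps only the
    identity is left. *)
Lemma solvable_band0 G : is_subgroup G -> (forall g, G g -> band 0 g) ->
  solvable_group G.
Proof.
move=> sG G0; apply: solvableS => //; exists n.+1.
suff kG k : iter k (@derived F n) G `<=` [set g | G g /\ band k (g - 1)].
  move=> g /kG[_ bg]; apply/eqP; rewrite -subr_eq0; apply/eqP/matrixP => i j.
  by rewrite bg ?mxE // (leq_trans (ltn_ord j)) ?leq_addr.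
elim: k => [|k IH] /=.
  by move=> g Gg; split=> //; apply: bandD; [apply: G0 | apply/bandN/band1].
apply: generated_sub; first exact: band_subgroup.
move=> _ [g [x [/IH[Gg kg] /IH[Gx kx] ->]]].
have [uG _ GM GV] := sG; have [ug ux] := (uG _ Gg, uG _ Gx).
have Gi : G (g^-1 * x^-1) by apply: GM; apply: GV.
split; first by do 2?apply: (GM).
have -> : g^-1 * x^-1 * g * x - 1
    = g^-1 * x^-1 * ((g - 1) * (x - 1) - (x - 1) * (g - 1)).
  have -> : (g - 1) * (x - 1) - (x - 1) * (g - 1) = g * x - x * g.
    have E a b : (a - 1) * (b - 1) = a * b - (a + b - 1) :> M.
      by rewrite mulrBl !mulrBr mul1r !mulr1 !opprD !opprK !addrA.
    by rewrite !E [x + g]addrC [- (x * g - _)]opprB addrA subrK.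
  by rewrite mulrBr !mulrA (mulrVK ux) mulVr.
by apply: (@bandM 0); [apply: G0 | apply: band_commutator].
Qed.

(** The two families generate a copy of SL_2, in which conjugation by a suitable diagonal element
    multiplies the parameter of a transvection by 4. Hence every transvection is a commutator, and
    both families survive in all derived subgroups. *)
Lemma opposite_transvections_not_solvable K (i j : 'I_n.+1) :
    is_subgroup K -> i != j ->
    (forall s, K (1 + s *: delta_mx i j)) ->
    (forall s, K (1 + s *: delta_mx j i)) ->
  ~ solvable_group K.
Proof.
have step G (a b : 'I_n.+1) : is_subgroup G -> a != b ->
    (forall s, G (1 + s *: delta_mx a b)) ->
    (forall s, G (1 + s *: delta_mx b a)) ->
    forall s, derived G (1 + s *: delta_mx a b).
  move=> sG ab Gab Gba s; have [uG _ GM GV] := sG.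
  pose x := delta_mx a b : M; pose y := delta_mx b a : M.
  have xx : x * x = 0 by rewrite /x -[LHS]/(_ *m _) mul_delta_mx_0 // eq_sym.
  have yy : y * y = 0 by rewrite /y -[LHS]/(_ *m _) mul_delta_mx_0.
  have xyx : x * y * x = x by rewrite -[LHS]/(_ *m _ *m _) !mul_delta_mx.
  (* With x(t) = 1 + t x, y(t) = 1 + t y and w(t) = x(t) y(-1/t) x(t), this is w(2) w(-1), the
     diagonal matrix with entries 2 and 1/2 in SL_2. Its two middle factors x(2) and x(-1) are
     merged into x(1). *)
  pose h : M := (1 + 2 *: x) * (1 + (- 2^-1) *: y) * (1 + 1 *: x) * (1 + 1 *: y)
                * (1 + (-1) *: x).
  have Gh : G h by rewrite /h; do 4?apply: (GM).
  have two : 2 != 0 :> F by rewrite pnatr_eq0.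
  have hx : h * x = 2 *: x.
    rewrite /h -!mulrA.
    have -> : (1 + (-1) *: x) * x = x.
      by rewrite mulrDl mul1r -scalerAl xx scaler0 addr0.
    have -> : (1 + 1 *: y) * x = x + y * x by rewrite mulrDl mul1r scale1r.
    have -> : (1 + 1 *: x) * (x + y * x) = 2 *: x + y * x.
      rewrite mulrDl mul1r scale1r mulrDr xx add0r mulrA xyx addrAC.
      by rewrite -mulr2n scaler_nat.
    have -> : (1 + (- 2^-1) *: y) * (2 *: x + y * x) = 2 *: x.
      rewrite mulrDl mul1r -scalerAl mulrDr -scalerAr mulrA yy mul0r addr0.
      by rewrite scalerA mulNr mulVf // scaleN1r addrK.
    by rewrite mulrDl mul1r -scalerAl -scalerAr xx !scaler0 addr0.
  have xh : x * h = 2^-1 *: x.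
    rewrite /h !mulrA.
    have -> : x * (1 + 2 *: x) = x by rewrite mulrDr mulr1 -scalerAr xx scaler0 addr0.
    have -> : x * (1 + (- 2^-1) *: y) = x - 2^-1 *: (x * y).
      by rewrite mulrDr mulr1 -scalerAr scaleNr.
    have -> : (x - 2^-1 *: (x * y)) * (1 + 1 *: x) = 2^-1 *: x - 2^-1 *: (x * y).
      rewrite scale1r mulrDr mulr1 mulrBl xx add0r -scalerAl xyx addrAC.
      by congr (_ - _); rewrite -{1}[x]scale1r -scalerBl; congr (_ *: _); field.
    have -> : (2^-1 *: x - 2^-1 *: (x * y)) * (1 + 1 *: y) = 2^-1 *: x.
      rewrite scale1r mulrDr mulr1 mulrBl -!scalerAl -[x * y * y]mulrA yy mulr0.
      by rewrite scaler0 subr0 subrK.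
    by rewrite mulrDr mulr1 -scalerAl -scalerAr xx !scaler0 addr0.
  have uh := uG _ Gh.
  have xhV : x * h^-1 = 2 *: x.
    apply: (mulIr uh); rewrite mulrVK // -scalerAl xh scalerA divff //.
    by rewrite scale1r.
  have txK c : (1 + c *: x) * (1 - c *: x) = 1.
    rewrite mulrDl mul1r -scalerAl mulrBr mulr1 -scalerAr xx !scaler0 subr0.
    by rewrite subrK.
  have uG' c : (1 - c *: x)^-1 = 1 + c *: x.
    have u : 1 - c *: x \is a GRing.unit by rewrite -scaleNr; apply/uG/Gab.
    by apply: (mulIr u); rewrite mulVr // txK.
  (* The first three factors form a transvection of parameter [4 * (s / 3)], the last one has
     parameter [- (s / 3)]; the sum is [s]. *)
  have -> : 1 + s *: x
      = h^-1^-1 * (1 - (s / 3) *: x)^-1 * h^-1 * (1 - (s / 3) *: x).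
    have -> : h^-1^-1 * (1 - (s / 3) *: x)^-1 * h^-1 = 1 + (4 * (s / 3)) *: x.
      rewrite invrK uG' mulrDr mulr1 -scalerAr hx mulrDl divrr // -!scalerAl xhV.
      by rewrite !scalerA; congr (1 + _ *: _); ring.
    rewrite mulrDl mul1r -scalerAl mulrBr mulr1 -scalerAr xx.
    rewrite !scaler0 subr0 -addrA; congr (_ + _); rewrite addrC -scalerBl.
    by congr (_ *: _); field.
  by apply: commutator_derived; [apply: GV | rewrite -scaleNr; apply: Gab].
move=> sK ij Kij Kji [k kK].
suff [] : (forall s, iter k (@derived F n) K (1 + s *: delta_mx i j)) /\
          (forall s, iter k (@derived F n) K (1 + s *: delta_mx j i)).
  move=> /(_ 1); rewrite kK => /= /eqP; rewrite -subr_eq0 addrC addKr scale1r.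
  by move=> /eqP/matrixP/(_ i j)/eqP; rewrite !mxE !eqxx oner_eq0.
elim: k {kK} => //= k [IHij IHji]; have sk := iter_derived_subgroup k sK.
by split; apply: step; rewrite // eq_sym.

Qed.

(* Let [j] be the first column of [g] violating triangularity and [i] the last
   nonzero row of that column. Some unitriangular [w] clears column [j] of [y = w g]
   except in row [i]; row [j] of [y] is zero up to column [j], so the transvections
   built on it are unitriangular, and [y] conjugates them to [1 + s E_ij] with
   [j < i]. Together with [1 + s E_ji] these generate a copy of SL_2. *)
Lemma solvable_upper K :
    is_subgroup K -> (forall u, band 1 (u - 1) -> K u) ->
    solvable_group K ->
  forall g, K g -> band 0 g.
Proof.
move=> sK UK solK g Kg; apply: contrapT => gN0.
have [j0 [i0 [ij0 gij0]]] : exists j i : 'I_n.+1, (j < i)%N /\ g i j != 0.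
  apply: contrapT => nex; apply: gN0 => i j ij; apply/eqP/negP => /negP gij.
  by apply: nex; exists j, i.
pose P (j : 'I_n.+1) := [exists i : 'I_n.+1, (j < i)%N && (g i j != 0)].
have Pj0 : P j0 by apply/existsP; exists i0; rewrite ij0.
case: (arg_minnP (fun j : 'I_n.+1 => j : nat) Pj0) => j.
move=> /existsP[i1 /andP[ij1 gij1]] jmin.
pose Q (i : 'I_n.+1) := g i j != 0.
case: (@arg_maxnP _ i1 Q (fun i => i : nat) gij1) => i gij imax.
have ji : (j < i)%N by apply: leq_trans ij1 _; apply: imax.
have g_left (i' l : 'I_n.+1) : (l < j)%N -> (l < i')%N -> g i' l = 0.
  move=> lj li; apply/eqP/negP => /negP gl; have: P l.
    by apply/existsP; exists i'; rewrite li.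
  by move/jmin; rewrite leqNgt lj.
have g_below (i' : 'I_n.+1) : (i < i')%N -> g i' j = 0.
  move=> ii'; apply/eqP/negP => /negP gl.
  by have := imax i' gl; rewrite /= leqNgt ii'.
have [uK K1 KM KV] := sK.
pose c (a : 'I_n.+1) := (a < i)%N%:R * (g a j / g i j).
pose w : M := 1 - \matrix_(a, b) ((b == i)%:R * c a).
have Kw : K w.
  apply: UK => a b; rewrite add1n ltnS => ba; rewrite /w addrAC subrr add0r !mxE /c.
  case: eqP => [bi|_]; last by rewrite mul0r oppr0.
  by rewrite ltnNge -bi ba mul0r mulr0 oppr0.
have [y Ky yE] : exists2 y, K y & forall a b, y a b = g a b - c a * g i b.
  exists (w * g) => [|a b]; first exact: KM.
  rewrite mulrBl mul1r !mxE; congr (_ - _).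
  rewrite (bigD1 i) //= big1 ?addr0 => [|m mi]; rewrite !mxE ?eqxx ?mul1r //.
  by rewrite (negPf mi) !mul0r.
have ycol : y * delta_mx j j = g i j *: delta_mx i j.
  apply/matrixP => a b; rewrite !mxE (bigD1 j) //= big1 ?addr0 => [|m mj].
    rewrite !mxE eqxx /= yE /c; case: (b == j); last by rewrite andbF !mulr0.
    rewrite andbT mulr1 -[in LHS]mulrA divfK // -val_eqE.
    case: ltngtP => [ai|ia|/val_inj ->]; rewrite ?mul0r ?mulr0 ?mul1r ?mulr1 ?subr0 //.
      by rewrite subrr.
    exact: g_below.
  by rewrite !mxE (negPf mj) mulr0.
have ui := uK _ Ky.
apply: (opposite_transvections_not_solvable (i := i) (j := j) sK _ _ _ solK).
- by rewrite -val_eqE gtn_eqF.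
- move=> s; pose u : M := 1 + (s / g i j) *: (delta_mx j j * y).
  have Ku : K u.
    apply: UK => a b; rewrite add1n ltnS => ba; rewrite /u addrC addKr mxE.
    rewrite mxE (bigD1 j) //= big1 ?addr0 => [|m mj]; last first.
      by rewrite !mxE (negPf mj) andbF mul0r.
    rewrite !mxE yE eqxx andbT; case: eqP => [aj|_]; last first.
      by rewrite mul0r mulr0.
    move: ba; rewrite aj /c ji !mul1r leq_eqVlt => /orP[/eqP/val_inj ->|bj].
      by rewrite divfK // subrr !mulr0.
    by rewrite !(g_left _ b) ?(ltn_trans bj ji) // mulr0 subrr mulr0.
  suff -> : 1 + s *: delta_mx i j = y * u * y^-1 by do 2?apply: (KM) => //; apply: KV.
  rewrite /u mulrDr mulr1 -scalerAr mulrA ycol -scalerAl scalerA divfK //.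
  by rewrite mulrDl divrr // -scalerAl mulrK.
- move=> s; apply: UK => a b; rewrite add1n ltnS => ba; rewrite addrC addKr !mxE.
  case: eqP => [aj|]; last by rewrite mulr0.
  case: eqP => [bi|]; last by rewrite mulr0.
  by move: ba; rewrite aj bi leqNgt ji.
Qed.

End Triangular.

(** * Integral 7 x 7 matrices *)

Section IntegerMatrices.
Variable F : numFieldType.
Local Notation M := 'M[F]_7.
Implicit Types (A B : M) (l m : seq (seq int)).

(* Rows and columns are numbered from 0 here, but from 1 in [E]. *)
Definition ent A (i j : nat) : F := A (inord i) (inord j).

Lemma sum7 (V : nmodType) (f : 'I_7 -> V) :
  \sum_i f i = f (inord 0) + f (inord 1) + f (inord 2) + f (inord 3)
             + f (inord 4) + f (inord 5) + f (inord 6).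
Proof.
by rewrite !big_ord_recr big_ord0 /= add0r; do !congr (_ + _); congr f;
   apply: val_inj; rewrite /= inordK.
Qed.

Lemma entM A B i j : ent (A * B) i j =
  ent A i 0 * ent B 0 j + ent A i 1 * ent B 1 j + ent A i 2 * ent B 2 j
  + ent A i 3 * ent B 3 j + ent A i 4 * ent B 4 j + ent A i 5 * ent B 5 j
  + ent A i 6 * ent B 6 j.
Proof. by rewrite /ent mxE sum7. Qed.

Lemma entT A i j : ent A^T i j = ent A j i.
Proof. by rewrite /ent mxE. Qed.

Lemma ent1 i j : (i < 7)%N -> (j < 7)%N -> ent 1 i j = (i == j)%:R.
Proof. by move=> i7 j7; rewrite /ent mxE -val_eqE /= !inordK. Qed.

Lemma ent_val A (i j : 'I_7) : ent A i j = A i j.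
Proof. by rewrite /ent !inord_val. Qed.

Lemma ent_ext A B :
  (forall i j, (i < 7)%N -> (j < 7)%N -> ent A i j = ent B i j) -> A = B.
Proof. by move=> AB; apply/matrixP => i j; rewrite -!ent_val AB. Qed.

(* Integral matrices are lists of lists, so that [vm_compute] evaluates them. *)
Definition zent l i j : int := nth 0 (nth [::] l i) j.

Definition zm l : M := \matrix_(i, j) (zent l i j)%:~R.

Definition ztab (f : nat -> nat -> int) : seq (seq int) :=
  mkseq (fun i => mkseq (f i) 7) 7.

Lemma zent_tab f i j : (i < 7)%N -> (j < 7)%N -> zent (ztab f) i j = f i j.
Proof. by move=> i7 j7; rewrite /zent !nth_mkseq. Qed.

Definition zsum (f : nat -> int) : int :=
  f 0%N + f 1%N + f 2%N + f 3%N + f 4%N + f 5%N + f 6%N.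

Definition zmul l m :=
  ztab (fun i j => zsum (fun k => zent l i k * zent m k j)).
Definition zlin (a : int) l m := ztab (fun i j => zent l i j + a * zent m i j).
Definition ztr l := ztab (fun i j => zent l j i).
Definition zunit i j := ztab (fun a b => ((a == i.-1) && (b == j.-1))%:Z).

Lemma ent_zm l i j : (i < 7)%N -> (j < 7)%N -> ent (zm l) i j = (zent l i j)%:~R.
Proof. by move=> i7 j7; rewrite /ent mxE !inordK. Qed.

Lemma zmM l m : zm l * zm m = zm (zmul l m).
Proof.
apply: ent_ext => i j i7 j7.
by rewrite entM !ent_zm // zent_tab // !rmorphD /= !rmorphM.
Qed.

Lemma zm_lin a l m : zm l + a%:~R *: zm m = zm (zlin a l m).
Proof. by apply/matrixP => i j; rewrite !mxE zent_tab // rmorphD rmorphM. Qed.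

Lemma zmT l : (zm l)^T = zm (ztr l).
Proof. by apply/matrixP => i j; rewrite !mxE zent_tab. Qed.

Lemma zm_unit i j : (0 < i <= 7)%N -> (0 < j <= 7)%N -> E F i j = zm (zunit i j).
Proof.
case: i j => [|i] [|j] //= i7 j7; apply/matrixP => a b.
by rewrite !mxE zent_tab // -!val_eqE /= !inordK.
Qed.

Lemma zmD l m : zm l + zm m = zm (zlin 1 l m).
Proof. by rewrite -zm_lin scale1r. Qed.

Definition zbracket l m := zlin (-1) (zmul l m) (zmul m l).

Lemma zm_bracket l m : bracket (zm l) (zm m) = zm (zbracket l m).
Proof. by rewrite /bracket !zmM -zm_lin scaleN1r. Qed.

Definition ze1 :=
  zlin 1 (zlin 1 (zlin 2 (zunit 1 2) (zunit 3 4)) (zunit 4 5)) (zunit 6 7).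
Definition ze2 := zlin 1 (zunit 2 3) (zunit 5 6).
Definition zf1 :=
  zlin 1 (zlin 2 (zlin 1 (zunit 2 1) (zunit 4 3)) (zunit 5 4)) (zunit 7 6).
Definition zf2 := zlin 1 (zunit 3 2) (zunit 6 5).

Definition zroot (s : bool) (r : posroot) : seq (seq int) :=
  let x1 := if s then ze1 else zf1 in
  let x2 := if s then ze2 else zf2 in
  let x11 := zbracket x1 x2 in
  let x21 := zbracket x1 x11 in
  let x31 := zbracket x1 x21 in
  match r with
  | R10 => x1 | R01 => x2 | R11 => x11 | R21 => x21 | R31 => x31
  | R32 => zbracket x2 x31
  end.

Lemma root_vectorE s r : root_vector F s r = zm (zroot s r).
Proof.
have e1E : e1 F = zm ze1.
  by rewrite /e1 !zm_unit // -[2]/(2%:~R) zm_lin !zmD.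
have e2E : e2 F = zm ze2 by rewrite /e2 !zm_unit // !zmD.
have f1E : f1 F = zm zf1.
  by rewrite /f1 !zm_unit // -[2]/(2%:~R) zmD zm_lin !zmD.
have f2E : f2 F = zm zf2 by rewrite /f2 !zm_unit // !zmD.
by case: s r => -[]; rewrite /root_vector ?e1E ?e2E ?f1E ?f2E ?zm_bracket.
Qed.

End IntegerMatrices.

(** * Octonion automorphisms *)

(* The alternating product on the 7-dimensional module (the imaginary octonions)
   and the quadratic form that the root vectors preserve, in the basis of
   weight vectors. *)
Definition crossf (R : pzRingType) (f g : nat -> R) : seq R :=
  [:: f 3 * g 0 *+ 2 - f 0 * g 3 *+ 2 + f 1 * g 2 *+ 2 - f 2 * g 1 *+ 2;
      f 4 * g 0 *+ 2 - f 0 * g 4 *+ 2 + f 1 * g 3 *+ 2 - f 3 * g 1 *+ 2;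
      f 5 * g 0 *+ 2 - f 0 * g 5 *+ 2 + f 2 * g 3 *+ 2 - f 3 * g 2 *+ 2;
      f 6 * g 0 - f 0 * g 6 + f 5 * g 1 - f 1 * g 5 + f 2 * g 4 - f 4 * g 2;
      f 6 * g 1 *+ 2 - f 1 * g 6 *+ 2 + f 3 * g 4 *+ 2 - f 4 * g 3 *+ 2;
      f 6 * g 2 *+ 2 - f 2 * g 6 *+ 2 + f 3 * g 5 *+ 2 - f 5 * g 3 *+ 2;
      f 6 * g 3 *+ 2 - f 3 * g 6 *+ 2 + f 4 * g 5 *+ 2 - f 5 * g 4 *+ 2].

Definition formf (R : pzRingType) (f g : nat -> R) : R :=
  f 0%N * g 6 + f 6 * g 0%N - (f 1%N * g 5 + f 5 * g 1%N)
  + (f 2 * g 4 + f 4 * g 2) - f 3 * g 3 *+ 2.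

Definition deltaf (R : pzRingType) (a k : nat) : R := (k == a)%:R.

Definition zcross (k : nat) : seq (seq int) :=
  ztab (fun i j => nth 0 (crossf (deltaf _ k) (deltaf _ j)) i).

Definition zform : seq (seq int) :=
  ztab (fun i j => formf (deltaf _ i) (deltaf _ j)).

Definition all_roots (P : bool -> posroot -> bool) : bool :=
  all (fun s => all (P s) [:: R10; R01; R11; R21; R31; R32]) [:: true; false].

Lemma all_rootsP P : all_roots P -> forall s r, P s r.
Proof.
rewrite /all_roots /= !andbT => PP s r; move: PP.
case/andP => /and5P[? ? ? ? /andP[? ?]] /and5P[? ? ? ? /andP[? ?]].
by case: s r => -[].
Qed.

(* Locked: comparing two distinct root elements by unfolding does not end. *)
HB.lock Definition root_elt (F : numFieldType) (s : bool) (r : posroot) (c : F) :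
  'M[F]_7 := exp_nilp (c *: root_vector F s r).

Section Octonions.
Variable F : numFieldType.
Local Notation M := 'M[F]_7.
Local Notation V := 'cV[F]_7.
Implicit Types (g h x y : M) (u v : V).

Definition crossmx v : M := \sum_i v i 0 *: zm F (zcross i).

Definition formmx : M := zm F zform.

(** [crossmx v] is the operator of left multiplication by [v], so the middle condition is the
    multiplicativity of [h] put as an identity of matrices. *)
Definition octonion_aut h : Prop :=
  [/\ h \is a GRing.unit,
      forall v, h * crossmx v = crossmx (h *m v) * h &
      h^T * formmx * h = formmx].

Fact crossmx_is_linear : linear crossmx.
Proof.
move=> a u v; rewrite /crossmx scaler_sumr -big_split; apply: eq_bigr => i _.
by rewrite !mxE scalerDl scalerA.
Qed.
HB.instance Definition _ :=
  GRing.isLinear.Build F V M *:%R crossmx crossmx_is_linear.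

Lemma octonion_aut_subgroup : is_subgroup octonion_aut.
Proof.
split=> [h []//||h g [uh Lh Jh] [ug Lg Jg]|h [uh Lh Jh]].
- split=> [|v|]; first exact: unitr1.
    by rewrite mul1r mulr1 mul1mx.
  by rewrite trmx1 mul1r mulr1.
- split; first by rewrite unitrMl.
    by move=> v; rewrite -mulrA Lg mulrA Lh -mulrA mulmxA.
  have -> : (h * g)^T = g^T * h^T by exact: trmx_mul.
  by rewrite mulrA -[g^T * _ * _]mulrA -[g^T * _ * _]mulrA Jh.
- have uhT : h^T \is a GRing.unit by rewrite unitmx_tr.
  split; first by rewrite unitrV.
    move=> v; apply: (mulrI uh); rewrite mulVKr // mulrA Lh.
    by rewrite mulrK // mulmxA -[h *m _]/(h * _) divrr // mul1mx.
  have -> : (h^-1)^T = (h^T)^-1 by exact: trmx_inv.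
  by rewrite -{1}Jh -[h^T * _ * _]mulrA mulKr // mulrK.
Qed.

Definition cross_derivation x : Prop :=
  forall v, x * crossmx v = crossmx v * x + crossmx (x *m v).

Lemma crossmx_delta (j : nat) : (j < 7)%N ->
  crossmx (delta_mx (inord j) 0) = zm F (zcross j).
Proof.
move=> j7; rewrite /crossmx (bigD1 (inord j)) //= big1 ?addr0 => [|i ij].
  by rewrite mxE !eqxx scale1r inordK.
by rewrite mxE (negPf ij) scale0r.
Qed.

(* The [let] makes [vm_compute] evaluate the table of structure constants once. *)
Definition zderivation (x : seq (seq int)) : bool :=
  let c := mkseq zcross 7 in
  all (fun j => zlin (-1) (zmul x (nth [::] c j)) (zmul (nth [::] c j) x) ==
         ztab (fun a b => zsum (fun i => zent x i j * zent (nth [::] c i) a b)))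
    (iota 0 7).

Lemma zderivation_root s r : zderivation (zroot s r).
Proof.
have rootsP : all_roots (fun s r => zderivation (zroot s r)) by vm_compute.
exact: all_rootsP rootsP s r.
Qed.

Definition znilp3 (x : seq (seq int)) : bool :=
  zmul x (zmul x x) == ztab (fun _ _ => 0).

(** A root string through the seven weights of the module has at most three terms, so the
    exponential of a root vector stops in degree two. *)
Lemma znilp3_root s r : znilp3 (zroot s r).
Proof.
have rootsP : all_roots (fun s r => znilp3 (zroot s r)) by vm_compute.
exact: all_rootsP rootsP s r.
Qed.

Definition zskew (x : seq (seq int)) : bool :=
  zlin 1 (zmul (ztr x) zform) (zmul zform x) == ztab (fun _ _ => 0).

Lemma zskew_root s r : zskew (zroot s r).
Proof.
have rootsP : all_roots (fun s r => zskew (zroot s r)) by vm_compute.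
exact: all_rootsP rootsP s r.
Qed.

Lemma zm0 : zm F (ztab (fun _ _ => 0)) = 0.
Proof. by apply/matrixP => i j; rewrite !mxE zent_tab. Qed.

Lemma root_vector_derivation s r : cross_derivation (root_vector F s r).
Proof.
have dE (j : nat) : (j < 7)%N -> zm F (zroot s r) * zm F (zcross j) =
    zm F (zcross j) * zm F (zroot s r)
    + crossmx (zm F (zroot s r) *m delta_mx (inord j) 0).
  move=> j7; have /allP/(_ j) := zderivation_root s r.
  rewrite mem_iota nth_mkseq // => /(_ j7)/eqP zE.
  apply/eqP; rewrite addrC -subr_eq -[_ - _]/(bracket _ _) zm_bracket /zbracket zE.
  apply/eqP/matrixP => a b; rewrite mxE zent_tab // /zsum !nth_mkseq //.
  rewrite /crossmx summxE sum7 !rmorphD.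
  have e k : (k < 7)%N ->
      (zm F (zroot s r) *m delta_mx (inord j) 0) (inord k) 0 =
      (zent (zroot s r) k j)%:~R.
    move=> k7; rewrite mxE (bigD1 (inord j)) //= big1 ?addr0 => [|i ij].
      by rewrite !mxE !eqxx mulr1 !inordK.
    by rewrite [X in _ * X]mxE (negPf ij) mulr0.
  have sE c (A : M) : (c *: A) a b = c * A a b by rewrite mxE.
  by rewrite !sE !e // !mxE !inordK // !rmorphM.
move=> v; rewrite root_vectorE; set x := zm F _ in dE *.
rewrite {1 2}/crossmx mulr_sumr mulr_suml.
have -> : x *m v = \sum_i v i 0 *: (x *m delta_mx i 0).
  rewrite {1}[v]matrix_sum_delta mulmx_sumr; apply: eq_bigr => i _.
  by rewrite big_ord1 -scalemxAr.
rewrite linear_sum -big_split; apply: eq_bigr => i _ /=.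
rewrite -scalerAr -scalerAl linearZ -scalerDr; congr (_ *: _).
by rewrite dE // inord_val.
Qed.

Lemma root_eltE s r (c : F) (x := root_vector F s r) :
  root_elt s r c = 1 + c *: x + (c ^+ 2 / 2) *: (x * x).
Proof.
have x3 : x * (x * x) = 0 by rewrite /x root_vectorE !zmM (eqP (znilp3_root s r)) zm0.
have xk k : (c *: x) ^+ k.+3 = 0.
  have -> : k.+3 = (1 + 1 + 1 + k)%N by [].
  by rewrite exprZn !exprD !expr1 -[x * x * x]mulrA x3 mul0r scaler0.
rewrite root_elt.unlock /exp_nilp !big_ord_recr big_ord0 /= !xk !scaler0 !addr0 add0r.
rewrite expr0 expr1 exprZn !expr2 !factE /= invr1 !scale1r ?mul1r scalerA.
by congr (_ + _ *: _); rewrite mulrC.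
Qed.

Lemma root_eltN s r (c : F) : root_elt s r c * root_elt s r (- c) = 1.
Proof.
rewrite !root_eltE sqrrN; set x := root_vector F s r; set e := c ^+ 2 / 2.
have x3 : x * x * x = 0.
  by rewrite -mulrA /x root_vectorE !zmM (eqP (znilp3_root s r)) zm0.
rewrite !mulrDl !mulrDr !mul1r !mulr1 -!scalerAl -!scalerAr !mulrA x3.
rewrite mul0r !scaler0 !addr0 !scalerA /e.
move: (x * x) => xx.
by apply/matrixP => i j; rewrite !mxE; field.
Qed.

Lemma root_elt_unit s r (c : F) : root_elt s r c \is a GRing.unit.
Proof.
by apply/unitrP; exists (root_elt s r (- c)); rewrite -{2}[c]opprK !root_eltN.
Qed.

(** The exponential of a derivation is an automorphism. As the exponentials are quadratic
    polynomials, the terms of degree 3 and 4 in the product of [crossmx (root_elt s r c *m v)] by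
    [root_elt s r c] must cancel; this follows from x^3 = 0 by commuting x past [crossmx v]. For the
    form, a skew x satisfies exp(x)^T J = J exp(-x). *)
Lemma root_elt_octonion_aut s r (c : F) : octonion_aut (root_elt s r c).
Proof.
have dx := root_vector_derivation s r; split; first exact: root_elt_unit.
  move=> v; rewrite root_eltE; set x := root_vector F s r in dx *.
  have x3 : x * x * x = 0.
    by rewrite -mulrA /x root_vectorE !zmM (eqP (znilp3_root s r)) zm0.
  rewrite !mulmxDl mul1mx -!scalemxAl !linearD !linearZ /=.
  rewrite -[(x * x) *m v]mulmxA.
  set l := crossmx v; set l1 := crossmx (x *m v).
  set l2 := crossmx (x *m (x *m v)).
  have xl : x * l = l * x + l1 := dx v.
  have xl1 : x * l1 = l1 * x + l2 := dx _.
  have xl2 : x * l2 = l2 * x.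
    have x3v : x *m (x *m (x *m v)) = 0.
      by rewrite !mulmxA -[x *m x *m x]/(x * x * x) x3 mul0mx.
    by rewrite /l2 dx x3v linear0 addr0.
  have xxl : x * x * l = l * x * x + l1 * x + l1 * x + l2.
    by rewrite -mulrA xl mulrDr mulrA xl xl1 mulrDl !addrA.
  have l12 : l2 * x = - (l1 * x * x).
    have xlxx : x * (l * x * x) = l1 * x * x.
      have lx3 : l * x * x * x = 0 by rewrite -!mulrA [x * (x * x)]mulrA x3 mulr0.
      by rewrite !mulrA xl !mulrDl lx3 add0r.
    have xl1x : x * (l1 * x) = l1 * x * x + l2 * x by rewrite mulrA xl1 mulrDl.
    (* [x ^ 3 * l = 0] expands to [3 * (l1 * x ^ 2 + l2 * x) = 0]. *)
    have: x * (x * x * l) = 0 by rewrite 2!mulrA x3 mul0r.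
    rewrite xxl !mulrDr xlxx xl1x xl2 => /matrixP eq0.
    apply/eqP; rewrite -addr_eq0; apply/eqP/matrixP => i j; have := eq0 i j.
    move: (l1 * x * x) (l2 * x) => a b; rewrite !mxE => eq3.
    have -> : b i j + a i j = (a i j + (a i j + b i j) + (a i j + b i j) + b i j) / 3.
      by field.
    by rewrite eq3 mul0r.
  have l22 : l2 * x * x = 0.
    by rewrite l12 mulNr -!mulrA [x * (x * x)]mulrA x3 mulr0 oppr0.
  rewrite !(mulrDl, mulrDr) !(mul1r, mulr1) -!(scalerAl, scalerAr) !mulrA.
  rewrite xl xxl l22 l12.
  by apply/matrixP => i j; rewrite !mxE; field.
have sx : (root_vector F s r)^T * formmx = - (formmx * root_vector F s r).
  apply/eqP; rewrite -addr_eq0 root_vectorE zmT !zmM zmD.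
  by rewrite (eqP (zskew_root s r)) zm0.
have -> : (root_elt s r c)^T * formmx = formmx * root_elt s r (- c).
  rewrite !root_eltE sqrrN; set x := root_vector F s r in sx *.
  have -> : (1 + c *: x + (c ^+ 2 / 2) *: (x * x))^T =
      1 + c *: x^T + (c ^+ 2 / 2) *: (x^T * x^T).
    by rewrite !linearD !linearZ /= trmx1 trmx_mul.
  rewrite !mulrDl !mulrDr mul1r mulr1 -!scalerAl -!scalerAr -[x^T * x^T * _]mulrA.
  rewrite sx mulrN mulrA sx.
  by rewrite mulNr opprK mulrA scalerN scaleNr.
by rewrite -mulrA -{2}[c]opprK root_eltN mulr1.
Qed.

End Octonions.

(** * The torus and the weight grading *)

Definition weight1 (i : nat) : int := nth 0 [:: 1; -1; 2; 0; -2; 1; -1] i.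
Definition weight2 (i : nat) : int := nth 0 [:: 0; 1; -1; 0; 1; -1; 0] i.

Section Torus.
Variable F : numFieldType.
Local Notation M := 'M[F]_7.
Implicit Types (g h x y : M) (c d : F).

Definition torus_weight c d (i : nat) : F := c ^ weight1 i * d ^ weight2 i.

Lemma torus_eltE c d (i j : 'I_7) :
  torus_elt c d i j = torus_weight c d i *+ (i == j).
Proof.
rewrite !mxE; congr (_ *+ _); rewrite /torus_weight.
by case: i => [] [|[|[|[|[|[|[|]]]]]]] //= _;
  rewrite /weight1 /weight2 /= ?expr0z ?mulr1 ?mul1r ?expr1z //; rewrite mulrC.
Qed.

Lemma torus_weightM c d c' d' i :
  torus_weight (c * c') (d * d') i = torus_weight c d i * torus_weight c' d' i.
Proof. by rewrite /torus_weight !expfzMl mulrACA. Qed.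

Lemma torus_eltM c d c' d' :
  torus_elt c d * torus_elt c' d' = torus_elt (c * c') (d * d').
Proof.
apply/matrixP => i j; rewrite torus_eltE mxE (bigD1 i) //= big1 ?addr0.
  by rewrite !torus_eltE eqxx mulr1n torus_weightM mulrnAr.
by move=> k ki; rewrite torus_eltE eq_sym (negPf ki) mulr0n mul0r.
Qed.

Lemma torus_elt1 : torus_elt 1 1 = 1 :> M.
Proof.
by apply/matrixP => i j; rewrite torus_eltE mxE /torus_weight !exp1rz mulr1.
Qed.

Lemma torus_eltV c d : c != 0 -> d != 0 ->
  torus_elt c d * torus_elt c^-1 d^-1 = 1.
Proof. by move=> c0 d0; rewrite torus_eltM !divff // torus_elt1. Qed.

Lemma torus_elt_unit c d : c != 0 -> d != 0 -> torus_elt c d \is a GRing.unit.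
Proof.
move=> c0 d0; apply/unitrP; exists (torus_elt c^-1 d^-1).
by rewrite torus_eltV // torus_eltM !mulVf // torus_elt1.
Qed.

Lemma torus_eltMl c d g (i j : 'I_7) :
  (torus_elt c d * g) i j = torus_weight c d i * g i j.
Proof.
rewrite mxE (bigD1 i) //= big1 ?addr0 => [|k ki].
  by rewrite torus_eltE eqxx.
by rewrite torus_eltE eq_sym (negPf ki) mul0r.
Qed.

Lemma torus_eltMr c d g (i j : 'I_7) :
  (g * torus_elt c d) i j = g i j * torus_weight c d j.
Proof.
rewrite mxE (bigD1 j) //= big1 ?addr0 => [|k kj].
  by rewrite torus_eltE eqxx.
by rewrite torus_eltE (negPf kj) mulr0.
Qed.

Definition weight_additive (w : nat -> int) : bool :=
  let c := mkseq zcross 7 in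
  all (fun i => all (fun a => all (fun b =>
    (zent (nth [::] c i) a b == 0) || (w a == w i + w b))
  (iota 0 7)) (iota 0 7)) (iota 0 7).

Lemma weight_additiveP w (i a b : 'I_7) : weight_additive w ->
  zent (zcross i) a b != 0 -> w a = w i + w b.
Proof.
have io (k : 'I_7) : (k : nat) \in iota 0 7 by rewrite mem_iota /=; case: k.
move=> /allP/(_ _ (io i))/allP/(_ _ (io a))/allP/(_ _ (io b)).
by rewrite nth_mkseq // => /orP[->|/eqP].
Qed.

Definition weight_opposite (w : nat -> int) : bool :=
  all (fun i => all (fun j => (zent zform i j == 0) || (w i + w j == 0))
  (iota 0 7)) (iota 0 7).

Lemma weight_oppositeP w (i j : 'I_7) : weight_opposite w ->
  zent zform i j != 0 -> w i + w j = 0.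
Proof.
have io (k : 'I_7) : (k : nat) \in iota 0 7 by rewrite mem_iota /=; case: k.
by move=> /allP/(_ _ (io i))/allP/(_ _ (io j))/orP[->|/eqP].
Qed.

(** The product is graded by the weights and the form pairs opposite weights. Both facts are checked
    on the tables of structure constants, for the values [weight1] and [weight2] of the weights on
    the two simple coroots. *)
Lemma torus_octonion_aut c d : c != 0 -> d != 0 -> octonion_aut (torus_elt c d).
Proof.
move=> c0 d0; split; first exact: torus_elt_unit.
  move=> v; apply/matrixP => a b; rewrite torus_eltMl torus_eltMr /crossmx.
  rewrite !summxE mulr_sumr mulr_suml; apply: eq_bigr => i _.
  have scaleE e (A : M) : (e *: A) a b = e * A a b by rewrite mxE.
  have zmE l : zm F l a b = (zent l a b)%:~R by rewrite mxE.
  rewrite !scaleE !zmE.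
  have -> : (torus_elt c d *m v) i 0 = torus_weight c d i * v i 0.
    rewrite mxE (bigD1 i) //= big1 ?addr0 => [|k ki].
      by rewrite torus_eltE eqxx.
    by rewrite torus_eltE eq_sym (negPf ki) mul0r.
  have [->|z0] := eqVneq (zent (zcross i) a b) 0; first by rewrite !(mulr0, mul0r).
  have w1 : weight_additive weight1 by vm_compute.
  have w2 : weight_additive weight2 by vm_compute.
  rewrite {1}/torus_weight (weight_additiveP w1 z0) (weight_additiveP w2 z0).
  rewrite !expfzDr // /torus_weight; ring.
have w1 : weight_opposite weight1 by vm_compute.
have w2 : weight_opposite weight2 by vm_compute.
apply/matrixP => i j; rewrite torus_eltMr.
have -> : (torus_elt c d)^T = torus_elt c d :> M.
  by apply/matrixP => a b; rewrite mxE !torus_eltE; case: eqVneq => [->|].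
rewrite torus_eltMl mxE.
have [->|z0] := eqVneq (zent zform i j) 0; first by rewrite mulr0 mul0r.
rewrite mulrAC -[RHS]mul1r; congr (_ * _).
rewrite /torus_weight mulrACA -!expfzDr //.
by rewrite (weight_oppositeP w1 z0) (weight_oppositeP w2 z0) !expr0z mulr1.
Qed.

End Torus.

(** * Root elements as row and column operations; equations between matrix entries *)

Ltac eval_roots :=
  (* Squares are evaluated before the roots themselves, whose replacement would destroy the pattern
     of a square. *)
  repeat match goal with |- context [zmul (zroot ?s ?r) (zroot ?s ?r)] =>
    let l := eval vm_compute in (zmul (zroot s r) (zroot s r)) in
    rewrite (_ : zmul (zroot s r) (zroot s r) = l); last by vm_compute
  end;
  repeat match goal with |- context [zroot ?s ?r] =>
    let l := eval vm_compute in (zroot s r) in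
    rewrite (_ : zroot s r = l); last by vm_compute
  end.

Section RowOperations.
Variable F : numFieldType.
Local Notation M := 'M[F]_7.
Implicit Types (g h x y : M) (c d : F).

Lemma ent_root_elt s r c i j : (i < 7)%N -> (j < 7)%N ->
  ent (root_elt s r c) i j = (i == j)%:R + c * (zent (zroot s r) i j)%:~R
    + c ^+ 2 / 2 * (zent (zmul (zroot s r) (zroot s r)) i j)%:~R.
Proof.
move=> i7 j7; rewrite root_eltE root_vectorE zmM.
by rewrite -ent1 // -!ent_zm // /ent !mxE.
Qed.

Lemma row_R10 c g i j : (i < 7)%N -> (j < 7)%N ->
  ent (root_elt true R10 c * g) i j = nth 0
   [:: ent g 0 j + c * ent g 1 j;
       ent g 1 j;
       ent g 2 j + 2 * c * ent g 3 j + c ^+ 2 * ent g 4 j;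
       ent g 3 j + c * ent g 4 j;
       ent g 4 j;
       ent g 5 j + c * ent g 6 j;
       ent g 6 j] i.
Proof.
move=> i7 j7; rewrite entM !ent_root_elt //; eval_roots.
by case: i i7 => [|[|[|[|[|[|[|]]]]]]] // _; rewrite /zent /=; field.
Qed.

Lemma row_R01 c g i j : (i < 7)%N -> (j < 7)%N ->
  ent (root_elt true R01 c * g) i j = nth 0
   [:: ent g 0 j;
       ent g 1 j + c * ent g 2 j;
       ent g 2 j;
       ent g 3 j;
       ent g 4 j + c * ent g 5 j;
       ent g 5 j;
       ent g 6 j] i.
Proof.
move=> i7 j7; rewrite entM !ent_root_elt //; eval_roots.
by case: i i7 => [|[|[|[|[|[|[|]]]]]]] // _; rewrite /zent /=; field.
Qed.

Lemma row_R11 c g i j : (i < 7)%N -> (j < 7)%N ->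
  ent (root_elt true R11 c * g) i j = nth 0
   [:: ent g 0 j + c * ent g 2 j;
       ent g 1 j - 2 * c * ent g 3 j - c ^+ 2 * ent g 5 j;
       ent g 2 j;
       ent g 3 j + c * ent g 5 j;
       ent g 4 j - c * ent g 6 j;
       ent g 5 j;
       ent g 6 j] i.
Proof.
move=> i7 j7; rewrite entM !ent_root_elt //; eval_roots.
by case: i i7 => [|[|[|[|[|[|[|]]]]]]] // _; rewrite /zent /=; field.
Qed.

(** Root vectors are plain iterated brackets. Up to sign, that of [R21] is twice a Chevalley basis
    vector and those of [R31] and [R32] are six times one; hence the factors 2, 4 and 6 here and in
    the next two lemmas. *)
Lemma row_R21 c g i j : (i < 7)%N -> (j < 7)%N ->
  ent (root_elt true R21 c * g) i j = nth 0
   [:: ent g 0 j - 4 * c * ent g 3 j + 4 * c ^+ 2 * ent g 6 j;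
       ent g 1 j + 2 * c * ent g 4 j;
       ent g 2 j + 2 * c * ent g 5 j;
       ent g 3 j - 2 * c * ent g 6 j;
       ent g 4 j;
       ent g 5 j;
       ent g 6 j] i.
Proof.
move=> i7 j7; rewrite entM !ent_root_elt //; eval_roots.
by case: i i7 => [|[|[|[|[|[|[|]]]]]]] // _; rewrite /zent /=; field.
Qed.

Lemma row_R31 c g i j : (i < 7)%N -> (j < 7)%N ->
  ent (root_elt true R31 c * g) i j = nth 0
   [:: ent g 0 j + 6 * c * ent g 4 j;
       ent g 1 j;
       ent g 2 j - 6 * c * ent g 6 j;
       ent g 3 j;
       ent g 4 j;
       ent g 5 j;
       ent g 6 j] i.
Proof.
move=> i7 j7; rewrite entM !ent_root_elt //; eval_roots.
by case: i i7 => [|[|[|[|[|[|[|]]]]]]] // _; rewrite /zent /=; field.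
Qed.

Lemma row_R32 c g i j : (i < 7)%N -> (j < 7)%N ->
  ent (root_elt true R32 c * g) i j = nth 0
   [:: ent g 0 j - 6 * c * ent g 5 j;
       ent g 1 j - 6 * c * ent g 6 j;
       ent g 2 j;
       ent g 3 j;
       ent g 4 j;
       ent g 5 j;
       ent g 6 j] i.
Proof.
move=> i7 j7; rewrite entM !ent_root_elt //; eval_roots.
by case: i i7 => [|[|[|[|[|[|[|]]]]]]] // _; rewrite /zent /=; field.
Qed.

Lemma row_N10 c g i j : (i < 7)%N -> (j < 7)%N ->
  ent (root_elt false R10 c * g) i j = nth 0
   [:: ent g 0 j;
       ent g 1 j + c * ent g 0 j;
       ent g 2 j;
       ent g 3 j + c * ent g 2 j;
       ent g 4 j + 2 * c * ent g 3 j + c ^+ 2 * ent g 2 j;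
       ent g 5 j;
       ent g 6 j + c * ent g 5 j] i.
Proof.
move=> i7 j7; rewrite entM !ent_root_elt //; eval_roots.
by case: i i7 => [|[|[|[|[|[|[|]]]]]]] // _; rewrite /zent /=; field.
Qed.

Lemma row_N01 c g i j : (i < 7)%N -> (j < 7)%N ->
  ent (root_elt false R01 c * g) i j = nth 0
   [:: ent g 0 j;
       ent g 1 j;
       ent g 2 j + c * ent g 1 j;
       ent g 3 j;
       ent g 4 j;
       ent g 5 j + c * ent g 4 j;
       ent g 6 j] i.
Proof.
move=> i7 j7; rewrite entM !ent_root_elt //; eval_roots.
by case: i i7 => [|[|[|[|[|[|[|]]]]]]] // _; rewrite /zent /=; field.
Qed.

Lemma col_R10 c g i j : (i < 7)%N -> (j < 7)%N ->
  ent (g * root_elt true R10 c) i j = nth 0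
   [:: ent g i 0;
       ent g i 1 + c * ent g i 0;
       ent g i 2;
       ent g i 3 + 2 * c * ent g i 2;
       ent g i 4 + c * ent g i 3 + c ^+ 2 * ent g i 2;
       ent g i 5;
       ent g i 6 + c * ent g i 5] j.
Proof.
move=> i7 j7; rewrite entM !ent_root_elt //; eval_roots.
by case: j j7 => [|[|[|[|[|[|[|]]]]]]] // _; rewrite /zent /=; field.
Qed.

Lemma col_N10 c g i j : (i < 7)%N -> (j < 7)%N ->
  ent (g * root_elt false R10 c) i j = nth 0
   [:: ent g i 0 + c * ent g i 1;
       ent g i 1;
       ent g i 2 + c * ent g i 3 + c ^+ 2 * ent g i 4;
       ent g i 3 + 2 * c * ent g i 4;
       ent g i 4;
       ent g i 5 + c * ent g i 6;
       ent g i 6] j.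
Proof.
move=> i7 j7; rewrite entM !ent_root_elt //; eval_roots.
by case: j j7 => [|[|[|[|[|[|[|]]]]]]] // _; rewrite /zent /=; field.
Qed.

Lemma crossmx_mul (v : 'cV[F]_7) (y : nat -> F) i : (i < 7)%N ->
  ent (crossmx v) i 0 * y 0%N + ent (crossmx v) i 1 * y 1%N
  + ent (crossmx v) i 2 * y 2 + ent (crossmx v) i 3 * y 3
  + ent (crossmx v) i 4 * y 4 + ent (crossmx v) i 5 * y 5
  + ent (crossmx v) i 6 * y 6
  = nth 0 (crossf (fun k => v (inord k) 0) y) i.
Proof.
move=> i7.
have E j : (j < 7)%N -> ent (crossmx v) i j =
    \sum_(k < 7) v k 0 * (zent (zcross k) i j)%:~R.
  move=> j7; rewrite /ent summxE; apply: eq_bigr => k _.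
  by rewrite !mxE !inordK.
rewrite !E // !sum7 !inordK //.
repeat match goal with |- context [zcross ?k] =>
  let l := eval vm_compute in (zcross k) in
  rewrite (_ : zcross k = l); last by vm_compute
end.
by case: i i7 {E} => [|[|[|[|[|[|[|]]]]]]] // _; rewrite /zent /=; ring.
Qed.

(** Column [b] of the automorphism identity taken at v = e_a: coordinate [i] of the image of the
    product of e_a and e_b. These scalar equations, with those of the form, drive all the
    eliminations. *)
Lemma octonion_aut_cross h i a b :
  octonion_aut h -> (i < 7)%N -> (a < 7)%N -> (b < 7)%N ->
  let m := crossf (deltaf F a) (deltaf F b) in
  ent h i 0 * nth 0 m 0 + ent h i 1 * nth 0 m 1 + ent h i 2 * nth 0 m 2
  + ent h i 3 * nth 0 m 3 + ent h i 4 * nth 0 m 4 + ent h i 5 * nth 0 m 5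
  + ent h i 6 * nth 0 m 6
  = nth 0 (crossf (ent h ^~ a) (ent h ^~ b)) i.
Proof.
move=> [_ Lh _] i7 a7 b7 m.
have := congr1 (fun A => ent A i b) (Lh (delta_mx (inord a) 0)).
rewrite !entM (crossmx_mul _ (ent h ^~ b) i7).
have -> : (fun k => (h *m (delta_mx (inord a) 0 : 'cV[F]_7)) (inord k) 0) = ent h ^~ a.
  apply/funext => k; rewrite mxE (bigD1 (inord a)) //= big1 ?addr0 => [|l la].
    by rewrite mxE !eqxx mulr1.
  by rewrite mxE (negPf la) mulr0.
have E j : (j < 7)%N -> ent (crossmx (delta_mx (inord a) 0 : 'cV[F]_7)) j b = nth 0 m j.
  move=> j7; rewrite crossmx_delta // ent_zm // zent_tab // /m /crossf.
  by case: j j7 => [|[|[|[|[|[|[|]]]]]]] // _; rewrite /= /deltaf;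
     rewrite !(rmorphB, rmorphD, rmorphM, rmorphMn) /= ?rmorph1.
by rewrite !E.
Qed.

Lemma octonion_aut_form h a b :
  octonion_aut h -> (a < 7)%N -> (b < 7)%N ->
  formf (ent h ^~ a) (ent h ^~ b) = formf (deltaf F a) (deltaf F b).
Proof.
move=> [_ _ Jh] a7 b7.
have := congr1 (fun A => ent A a b) Jh.
have E i j : (i < 7)%N -> (j < 7)%N ->
    ent (formmx F) i j = formf (deltaf F i) (deltaf F j).
  move=> i7 j7; rewrite ent_zm // zent_tab // /formf /deltaf.
  by rewrite !(rmorphB, rmorphD, rmorphM, rmorphMn) /= ?rmorph1.
rewrite !entM !entT !E // => <-; rewrite /formf /deltaf /=; ring.
Qed.

End RowOperations.

(** A linear certificate: once the known entries are substituted, the wanted equation is [k] times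
    one product or form equation. *)
Lemma deduce (F : fieldType) (k a b x y : F) : a = b -> x - y = k * (a - b) -> x = y.
Proof. by move=> -> /eqP; rewrite subrr mulr0 subr_eq0 => /eqP. Qed.

Ltac linear_in k eqn zeros :=
  apply: (deduce (k := k) eqn);
  rewrite /crossf /formf /deltaf /= ?zeros; by field.

(** * Upper triangular automorphisms *)

Section Upper.
Variable F : numFieldType.
Local Notation M := 'M[F]_7.
Implicit Types (g h x y : M) (c d : F).

Lemma ent_band0 h i j : band 0 h -> (j < i < 7)%N -> ent h i j = 0.
Proof.
by move=> U /andP[ji i7]; apply: U; rewrite add0n !inordK // (ltn_trans ji).
Qed.

Lemma band0_entries h : band 0 h ->
  (ent h 1 0 = 0) * (ent h 2 0 = 0) * (ent h 3 0 = 0) * (ent h 4 0 = 0) *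
  (ent h 5 0 = 0) * (ent h 6 0 = 0) * (ent h 2 1 = 0) * (ent h 3 1 = 0) *
  (ent h 4 1 = 0) * (ent h 5 1 = 0) * (ent h 6 1 = 0) * (ent h 3 2 = 0) *
  (ent h 4 2 = 0) * (ent h 5 2 = 0) * (ent h 6 2 = 0) * (ent h 4 3 = 0) *
  (ent h 5 3 = 0) * (ent h 6 3 = 0) * (ent h 5 4 = 0) * (ent h 6 4 = 0) *
  (ent h 6 5 = 0).
Proof. by move=> U; do !split; apply: ent_band0. Qed.

Lemma upper_diag h : octonion_aut h -> band 0 h ->
  [/\ ent h 0 0 * ent h 6 6 = 1, ent h 1 1 * ent h 5 5 = 1,
      ent h 2 2 * ent h 4 4 = 1 & ent h 3 3 ^+ 2 = 1].
Proof.
move=> hA /band0_entries Z; split.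
- apply: (deduce (k := 1) (octonion_aut_form hA (a := 0%N) (b := 6%N) isT isT)).
  by rewrite /formf /deltaf /= !Z; ring.
- apply: (deduce (k := -1) (octonion_aut_form hA (a := 1%N) (b := 5%N) isT isT)).
  by rewrite /formf /deltaf /= !Z; ring.
- apply: (deduce (k := 1) (octonion_aut_form hA (a := 2%N) (b := 4%N) isT isT)).
  by rewrite /formf /deltaf /= !Z; ring.
- apply: (deduce (k := - 2^-1) (octonion_aut_form hA (a := 3%N) (b := 3%N) isT isT)).
  by rewrite /formf /deltaf /= !Z; field.
Qed.

Lemma upper_diag_neq0 h : octonion_aut h -> band 0 h ->
  forall i, (i < 7)%N -> ent h i i != 0.
Proof.
move=> hA hU; have [E0 E1 E2 E3] := upper_diag hA hU.
have nz (a b : F) : a * b = 1 -> (a != 0) * (b != 0).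
  move=> ab; split; apply: contra_eq_neq ab => ->; rewrite ?mul0r ?mulr0 eq_sym;
  exact: oner_neq0.
case=> [|[|[|[|[|[|[|]]]]]]] // _;
  by rewrite ?(nz _ _ E0) ?(nz _ _ E1) ?(nz _ _ E2) ?(nz _ _ E3).
Qed.

(** The eight entries are coordinates on the Borel subgroup of G_2: (0,0) and (1,1) for the torus,
    then (0,1), (1,2), (0,2), (0,3), (0,4), (0,5) for the roots [R10], [R01], [R11], [R21], [R31],
    [R32]. Each further entry is found from one equation that is linear in it once the earlier ones
    are known. *)
Lemma upper_eq1 h : octonion_aut h -> band 0 h ->
  ent h 0 0 = 1 -> ent h 1 1 = 1 -> ent h 0 1 = 0 -> ent h 0 2 = 0 ->
  ent h 0 3 = 0 -> ent h 0 4 = 0 -> ent h 0 5 = 0 -> ent h 1 2 = 0 -> h = 1.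
Proof.
move=> hA hU h00 h11 h01 h02 h03 h04 h05 h12.
have [+ + _ _] := upper_diag hA hU; rewrite h00 h11 !mul1r => h66 h55.
have Z0 := (band0_entries hU, h00, h11, h01, h02, h03, h04, h05, h12, h66, h55).
have form a b := octonion_aut_form hA (a := a) (b := b).
have cross i a b := octonion_aut_cross hA (i := i) (a := a) (b := b).
have h35 : ent h 3 5 = 0.
  by linear_in (2^-1 : F) (cross 0%N 0%N 5%N isT isT isT) (Z0).
have h45 : ent h 4 5 = 0.
  by linear_in (2^-1 : F) (cross 1%N 0%N 5%N isT isT isT) (Z0, h35).
have h22 : ent h 2 2 = 1.
  by linear_in (- 2^-1 : F) (cross 2%N 0%N 5%N isT isT isT) (Z0, h35, h45).
have h34 : ent h 3 4 = 0.
  by linear_in (2^-1 : F) (cross 0%N 0%N 4%N isT isT isT) (Z0, h35, h45, h22).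
have h44 : ent h 4 4 = 1.
  by linear_in (2^-1 : F) (cross 1%N 0%N 4%N isT isT isT)
    (Z0, h35, h45, h22, h34).
have h36 : ent h 3 6 = 0.
  by linear_in (2^-1 : F) (cross 0%N 0%N 6%N isT isT isT)
    (Z0, h35, h45, h22, h34, h44).
have h33 : ent h 3 3 = 1.
  by linear_in (-1 : F) (cross 3%N 0%N 6%N isT isT isT)
    (Z0, h35, h45, h22, h34, h44, h36).
have h23 : ent h 2 3 = 0.
  by linear_in (- 2^-1 : F) (cross 0%N 1%N 3%N isT isT isT)
    (Z0, h35, h45, h22, h34, h44, h36, h33).
have h56 : ent h 5 6 = 0.
  by linear_in (2^-1 : F) (cross 2%N 0%N 6%N isT isT isT)
    (Z0, h35, h45, h22, h34, h44, h36, h33, h23).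
have h13 : ent h 1 3 = 0.
  by linear_in (2^-1 : F) (cross 0%N 2%N 3%N isT isT isT)
    (Z0, h35, h45, h22, h34, h44, h36, h33, h23, h56).
have h46 : ent h 4 6 = 0.
  by linear_in (2^-1 : F) (cross 1%N 0%N 6%N isT isT isT)
    (Z0, h35, h45, h22, h34, h44, h36, h33, h23, h56, h13).
have h25 : ent h 2 5 = 0.
  by linear_in (- 2^-1 : F) (cross 0%N 1%N 5%N isT isT isT)
    (Z0, h35, h45, h22, h34, h44, h36, h33, h23, h56, h13, h46).
have h15 : ent h 1 5 = 0.
  by linear_in (- 2^-1 : F) (form 5%N 5%N isT isT)
    (Z0, h35, h45, h22, h34, h44, h36, h33, h23, h56, h13, h46, h25).
have h14 : ent h 1 4 = 0.
  by linear_in (2^-1 : F) (cross 0%N 2%N 4%N isT isT isT)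
    (Z0, h35, h45, h22, h34, h44, h36, h33, h23, h56, h13, h46, h25, h15).
have h24 : ent h 2 4 = 0.
  by linear_in (- 2^-1 : F) (cross 0%N 1%N 4%N isT isT isT)
    (Z0, h35, h45, h22, h34, h44, h36, h33, h23, h56, h13, h46, h25, h15, h14).
have h26 : ent h 2 6 = 0.
  by linear_in (- 2^-1 : F) (cross 0%N 1%N 6%N isT isT isT)
    (Z0, h35, h45, h22, h34, h44, h36, h33, h23, h56, h13, h46, h25, h15, h14,
    h24).
have h16 : ent h 1 6 = 0.
  by linear_in (2^-1 : F) (cross 0%N 2%N 6%N isT isT isT)
    (Z0, h35, h45, h22, h34, h44, h36, h33, h23, h56, h13, h46, h25, h15, h14,
    h24, h26).
have h06 : ent h 0 6 = 0.
  by linear_in (2^-1 : F) (form 6%N 6%N isT isT)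
    (Z0, h35, h45, h22, h34, h44, h36, h33, h23, h56, h13, h46, h25, h15, h14,
    h24, h26, h16).
have Z := (Z0, h35, h45, h22, h34, h44, h36, h33, h23, h56, h13, h46, h25, h15,
    h14, h24, h26, h16, h06).
apply: ent_ext => i j i7 j7; rewrite ent1 //.
by case: i i7 => [|[|[|[|[|[|[|]]]]]]] // _;
   case: j j7 => [|[|[|[|[|[|[|]]]]]]] // _; rewrite Z.
Qed.

(** The form pairs e_i with e_(6-i), so the orthogonal complements of the first three steps of the
    standard flag are its steps of dimension 6, 5 and 4, and [h] preserves these as well. *)
Lemma flag_upper h : octonion_aut h ->
    (forall i j, (j < 3)%N -> (j < i < 7)%N -> ent h i j = 0) -> band 0 h.
Proof.
move=> hA flag.
have Z0 : (ent h 1 0 = 0) * (ent h 2 0 = 0) * (ent h 3 0 = 0) * (ent h 4 0 = 0) *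
  (ent h 5 0 = 0) * (ent h 6 0 = 0) * (ent h 2 1 = 0) * (ent h 3 1 = 0) *
  (ent h 4 1 = 0) * (ent h 5 1 = 0) * (ent h 6 1 = 0) * (ent h 3 2 = 0) *
  (ent h 4 2 = 0) * (ent h 5 2 = 0) * (ent h 6 2 = 0).
  by do !split; apply: flag.
have form a b := octonion_aut_form hA (a := a) (b := b).
have neq0l (a b x : F) : a * b = x -> x != 0 -> a != 0.
  by move=> <-; rewrite mulf_eq0 negb_or => /andP[].
have n00 : ent h 0 0 != 0.
  apply: (neq0l _ (ent h 6 6) 1); last exact: oner_neq0.
  by linear_in (1 : F) (form 0%N 6%N isT isT) (Z0).
have h65 : ent h 6 5 = 0.
  apply: (mulfI n00).
  by linear_in (1 : F) (form 0%N 5%N isT isT) (Z0).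
have h64 : ent h 6 4 = 0.
  apply: (mulfI n00).
  by linear_in (1 : F) (form 0%N 4%N isT isT) (Z0, h65).
have h63 : ent h 6 3 = 0.
  apply: (mulfI n00).
  by linear_in (1 : F) (form 0%N 3%N isT isT) (Z0, h65, h64).
have n11 : ent h 1 1 != 0.
  apply: (neq0l _ (ent h 5 5) 1); last exact: oner_neq0.
  by linear_in (-1 : F) (form 1%N 5%N isT isT) (Z0, h65, h64, h63).
have h54 : ent h 5 4 = 0.
  apply: (mulfI n11).
  by linear_in (-1 : F) (form 1%N 4%N isT isT) (Z0, h65, h64, h63).
have h53 : ent h 5 3 = 0.
  apply: (mulfI n11).
  by linear_in (-1 : F) (form 1%N 3%N isT isT) (Z0, h65, h64, h63, h54).
have n22 : ent h 2 2 != 0.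
  apply: (neq0l _ (ent h 4 4) 1); last exact: oner_neq0.
  by linear_in (1 : F) (form 2%N 4%N isT isT) (Z0, h65, h64, h63, h54, h53).
have h43 : ent h 4 3 = 0.
  apply: (mulfI n22).
  by linear_in (1 : F) (form 2%N 3%N isT isT) (Z0, h65, h64, h63, h54, h53).
have Z := (Z0, h65, h64, h63, h54, h53, h43).
move=> i j; rewrite add0n => ji; rewrite -ent_val; move: (ltn_ord i) ji.
by case: (i : nat) => [|[|[|[|[|[|[|]]]]]]] // _;
   case: (j : nat) => [|[|[|[|[|[|[|]]]]]]] // _; rewrite Z.
Qed.

End Upper.

(** * Stabilizers of flags *)

Section StableFlags.
Variables (F : numFieldType) (n : nat).
Local Notation M := 'M[F]_n.+1.
Implicit Types (g h : M) (k : nat).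

Definition stab k : set M :=
  [set g : M | g \is a GRing.unit /\ forall i j : 'I_n.+1, (j < k <= i)%N -> g i j = 0].

(** Stability under inverses is a dimension count: an injective map of a subspace into itself is
    onto. Since [mxalgebra] works with row spaces, the subspace is the row space of the projector
    [p] and [g] acts through its transpose. *)
Lemma stab_subgroup k : is_subgroup (stab k).
Proof.
pose p : M := \matrix_(i, j) ((i == j) && (i < k)%N)%:R.
have pM (A : M) i j : (p *m A) i j = (i < k)%N%:R * A i j.
  rewrite mxE (bigD1 i) //= big1 ?addr0 => [|l li]; first by rewrite mxE eqxx.
  by rewrite mxE eq_sym (negPf li) mul0r.
have Mp (A : M) i j : (A *m p) i j = A i j * (j < k)%N%:R.
  rewrite mxE (bigD1 j) //= big1 ?addr0 => [|l lj]; first by rewrite mxE eqxx.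
  by rewrite mxE (negPf lj) mulr0.
have subp (A : M) : (p *m A <= p)%MS =
    [forall i : 'I_n.+1, forall j : 'I_n.+1, (i < k <= j)%N ==> (A i j == 0)].
  apply/idP/'forall_'forall_implyP => [/submxP[D pA] i j /andP[ik kj]|A0].
    have : (p *m A) i j = 0 by rewrite pA Mp ltnNge kj mulr0.
    by rewrite pM ik mul1r => ->.
  apply/submxP; exists (p *m A); apply/matrixP => i j; rewrite Mp pM.
  case: ltnP => ik; rewrite ?mul0r // mul1r; case: ltnP => kj; rewrite ?mulr1 ?mulr0 //.
  by apply/eqP/A0; rewrite ik.
split=> [g [] //||g h [ug g0] [uh h0]|g [ug g0]].
- split=> [|i j /andP[jk ki]]; first exact: unitr1.
  by rewrite mxE -val_eqE gtn_eqF // (leq_trans jk).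
- split=> [|i j /andP[jk ki]]; first by rewrite unitrMl.
  rewrite mxE big1 // => l _; have [lk|kl] := ltnP l k.
    by rewrite g0 ?mul0r // lk.
  by rewrite h0 ?mulr0 // jk.
have ugT : g^T \in unitmx by rewrite unitmx_tr.
split=> [|i j jki]; first by rewrite unitrV.
have sp : (p *m g^T <= p)%MS.
  by rewrite subp; apply/'forall_'forall_implyP => a b ab; rewrite mxE g0.
have : (p <= p *m g^T)%MS.
  rewrite -(geq_leqif (mxrank_leqif_sup sp)) mxrankMfree //.
  by rewrite row_free_unit.
move=> /(submxMr (invmx g^T)); rewrite mulmxK // subp.
move=> /'forall_'forall_implyP/(_ j i jki)/eqP.
by rewrite -trmx_inv mxE.
Qed.

Lemma stab_diag_neq0 g : stab 1 g -> g 0 0 != 0.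
Proof.
move=> [ug g0]; have := congr1 (fun A : M => A 0 0) (mulVr ug).
rewrite !mxE big_ord_recl big1 ?addr0 => [|i _]; last by rewrite g0 ?mulr0.
by move=> E; apply/eqP => g00; move/eqP: E; rewrite g00 mulr0 eq_sym oner_eq0.
Qed.

Lemma stab1_mul g h i : stab 1 h -> (g * h) i 0 = g i 0 * h 0 0.
Proof.
by move=> [_ h0]; rewrite mxE big_ord_recl big1 ?addr0 // => l _; rewrite h0 ?mulr0.
Qed.

Lemma band0_stab k g : g \is a GRing.unit -> band 0 g -> stab k g.
Proof.
by move=> ug g0; split=> // i j /andP[jk ki]; apply: g0; apply: leq_trans jk ki.
Qed.

Lemma commutant_subgroup (d : M) :
  is_subgroup [set g : M | g \is a GRing.unit /\ g * d = d * g].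
Proof.
split=> [g [] //||g h [ug gd] [uh hd]|g [ug gd]].
- by split; rewrite ?unitr1 ?mulr1 ?mul1r.
- by split; rewrite ?unitrMl // -mulrA hd mulrA gd mulrA.
- split; rewrite ?unitrV //; apply: (mulrI ug); rewrite mulVKr // mulrA gd.
  by rewrite mulrK.
Qed.

End StableFlags.

(** [Z] marks the entries that are to vanish in 1 + c x + (c^2 / 2) x^2 for all c; the three
    conditions deal with the three terms. *)
Definition zsupported (Z : nat -> nat -> bool) (x : seq (seq int)) : bool :=
  let xx := zmul x x in
  all (fun i => all (fun j => Z i j ==>
    [&& i != j, zent x i j == 0 & zent xx i j == 0]) (iota 0 7)) (iota 0 7).

(* The summand of [7 = 3 + 3^* + 1] under [A2_long] to which a basis vector belongs. *)
Definition colour (i : nat) : nat := nth 0%N [:: 0; 1; 1; 2; 0; 0; 1]%N i.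

(** * Invariants of the generated groups *)

Section Generators.
Variable F : numFieldType.
Local Notation M := 'M[F]_7.
Implicit Types (g h x y : M) (c d : F).

Lemma root_elt_eq0 Z s r c : zsupported Z (zroot s r) ->
  forall i j : 'I_7, Z i j -> root_elt s r c i j = 0.
Proof.
move=> zZ i j Zij; have io (k : 'I_7) : (k : nat) \in iota 0 7.
  by rewrite mem_iota ltn_ord.
move: zZ => /allP/(_ _ (io i))/allP/(_ _ (io j)).
rewrite Zij /= => /and3P[ij /eqP z1 /eqP z2].
by rewrite -ent_val ent_root_elt // z1 z2 (negPf ij) !mulr0 !addr0.
Qed.

Lemma root_elt_band0 r c : band 0 (root_elt true r c : M).
Proof.
have Zr : zsupported (fun i j => (j < i)%N) (zroot true r) by case: r; vm_compute.
by move=> i j; apply: root_elt_eq0 Zr _ _.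
Qed.

Lemma torus_band0 c d : band 0 (torus_elt c d : M).
Proof. by move=> i j ji; rewrite torus_eltE -val_eqE gtn_eqF. Qed.

Definition coloured : set M :=
  [set g : M | forall i j : 'I_7, colour i != colour j -> g i j = 0].

(** Respecting the colours means commuting with the diagonal matrix [d] of colours, as distinct
    colours stay distinct in characteristic 0, and the invertible elements of a commutant form a
    group. *)
Lemma subset_coloured S : S `<=` coloured -> S `<=` [set g : M | g \is a GRing.unit] ->
  generated S `<=` coloured.
Proof.
move=> Sc Su; pose d : M := diag_mx (\row_j (colour j)%:R).
have dE g (i j : 'I_7) : (g * d) i j = g i j * (colour j)%:R.
  by rewrite -[g * d]/(g *m d) mul_mx_diag !mxE.
have dE' g (i j : 'I_7) : (d * g) i j = (colour i)%:R * g i j.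
  by rewrite -[d * g]/(d *m g) mul_diag_mx !mxE.
have /(generated_sub (commutant_subgroup d)) Sd :
    S `<=` [set g : M | g \is a GRing.unit /\ g * d = d * g].
  move=> g Sg; split; first exact: Su.
  apply/matrixP => i j; rewrite dE dE' mulrC.
  by have [->//|ij] := eqVneq (colour i) (colour j); rewrite (Sc g Sg) // !mulr0.
move=> g /Sd[_ /matrixP gd] i j ij; have := gd i j; rewrite dE dE' => /eqP.
rewrite mulrC -subr_eq0 -mulrBl mulf_eq0 subr_eq0 eqr_nat eq_sym (negPf ij).
by move=> /eqP.
Qed.

Lemma torus_coloured c d : coloured (torus_elt c d : M).
Proof.
move=> i j; rewrite torus_eltE; have [->|_] := eqVneq i j; by rewrite ?eqxx.
Qed.

Lemma long_root_coloured s r c : is_long r -> coloured (root_elt s r c : M).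
Proof.
move=> rl.
have Zr : zsupported (fun i j => colour i != colour j) (zroot s r).
  by case: s r rl => -[] // _; vm_compute.
by move=> i j; apply: root_elt_eq0 Zr _ _.
Qed.

Lemma torusP (g : M) : torus g -> octonion_aut g.
Proof. by move=> [c [d [c0 d0 ->]]]; apply: torus_octonion_aut. Qed.

Lemma root_subgroupP s r (g : M) : root_subgroup s r g -> exists c, g = root_elt s r c.
Proof. by move=> [c _ <-]; exists c; rewrite root_elt.unlock. Qed.

Lemma root_subgroup_elt s r c : root_subgroup s r (root_elt s r c : M).
Proof. by exists c; rewrite ?root_elt.unlock. Qed.

Lemma octonion_aut_unit h : octonion_aut h -> h \is a GRing.unit.
Proof. by case. Qed.

Lemma generated_octonion_aut S : S `<=` @octonion_aut F ->
  is_subgroup (generated S) /\ generated S `<=` @octonion_aut F.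
Proof.
move=> SA; split; first by apply: generated_subgroup => g /SA[].
by apply: generated_sub => //; apply: octonion_aut_subgroup.
Qed.

Lemma G2_octonion_aut : is_subgroup (G2 F) /\ G2 F `<=` @octonion_aut F.
Proof.
apply: generated_octonion_aut => g [/torusP//|[s _ [r _ /root_subgroupP[c ->]]]].
exact: root_elt_octonion_aut.
Qed.

Lemma std_borel_octonion_aut :
  is_subgroup (std_borel F) /\ std_borel F `<=` @octonion_aut F.
Proof.
apply: generated_octonion_aut => g [/torusP//|[r _ /root_subgroupP[c ->]]].
exact: root_elt_octonion_aut.
Qed.

Lemma std_borel_torus c d : c != 0 -> d != 0 -> std_borel F (torus_elt c d).
Proof. by move=> c0 d0; apply: sub_generated; left; exists c, d. Qed.

Lemma std_borel_root r c : std_borel F (root_elt true r c).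
Proof. by apply: sub_generated; right; exists r => //; apply: root_subgroup_elt. Qed.


Lemma P1_octonion_aut : is_subgroup (P1 F) /\ P1 F `<=` @octonion_aut F.
Proof.
have [_ BA] := std_borel_octonion_aut.
apply: generated_octonion_aut => g [/BA//|/root_subgroupP[c ->]].
exact: root_elt_octonion_aut.
Qed.

Lemma P2_octonion_aut : is_subgroup (P2 F) /\ P2 F `<=` @octonion_aut F.
Proof.
have [_ BA] := std_borel_octonion_aut.
apply: generated_octonion_aut => g [/BA//|/root_subgroupP[c ->]].
exact: root_elt_octonion_aut.
Qed.

Lemma A2_long_octonion_aut : is_subgroup (A2_long F) /\ A2_long F `<=` @octonion_aut F.
Proof.
apply: generated_octonion_aut => g [/torusP//|[s _ [r _ /root_subgroupP[c ->]]]].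
exact: root_elt_octonion_aut.
Qed.

Lemma A2_long_coloured : A2_long F `<=` coloured.
Proof.
apply: subset_coloured => g [[c [d [c0 d0 ->]]]|[s _ [r rl /root_subgroupP[c ->]]]].
- exact: torus_coloured.
- exact: long_root_coloured.
- exact: torus_elt_unit.
- exact: root_elt_unit.
Qed.

Lemma A2_long_torus c d : c != 0 -> d != 0 -> A2_long F (torus_elt c d).
Proof. by move=> c0 d0; apply: sub_generated; left; exists c, d. Qed.

Lemma A2_long_root s r c : is_long r -> A2_long F (root_elt s r c).
Proof.
move=> rl; apply: sub_generated; right; exists s => //; exists r => //.
exact: root_subgroup_elt.
Qed.

Lemma std_borel_stab k : std_borel F `<=` stab k.
Proof.
apply: generated_sub; first exact: stab_subgroup.
move=> g [[c [d [c0 d0 ->]]]|[r _ /root_subgroupP[c ->]]].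
  by apply: band0_stab; [apply: torus_elt_unit | apply: torus_band0].
by apply: band0_stab; [apply: root_elt_unit | apply: root_elt_band0].
Qed.

Lemma P1_stab : P1 F `<=` stab 1.
Proof.
apply: generated_sub; first exact: stab_subgroup.
move=> g [/std_borel_stab//|/root_subgroupP[c ->]]; split; first exact: root_elt_unit.
by apply: (@root_elt_eq0 (fun i j => (j < 1 <= i)%N)); vm_compute.
Qed.

Lemma P2_stab : P2 F `<=` stab 2.
Proof.
apply: generated_sub; first exact: stab_subgroup.
move=> g [/std_borel_stab//|/root_subgroupP[c ->]]; split; first exact: root_elt_unit.
by apply: (@root_elt_eq0 (fun i j => (j < 2 <= i)%N)); vm_compute.
Qed.

Lemma std_borel_P1 : std_borel F `<=` P1 F.
Proof. by move=> g Bg; apply: sub_generated; left. Qed.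

Lemma std_borel_P2 : std_borel F `<=` P2 F.
Proof. by move=> g Bg; apply: sub_generated; left. Qed.

Lemma G2_root s r c : G2 F (root_elt s r c).
Proof.
apply: sub_generated; right; exists s => //; exists r => //.
exact: root_subgroup_elt.
Qed.

End Generators.

(** * Elimination by torus and root elements *)

Section Reduction.
Variable F : numFieldType.
Local Notation M := 'M[F]_7.
Implicit Types (g h x y : M) (c d : F).

Lemma torus_weightE c d i : (i < 7)%N -> torus_weight c d i =
  nth 0 [:: c; d / c; c ^+ 2 / d; 1; d / c ^+ 2; c / d; c^-1] i.
Proof.
move=> i7; have := torus_eltE c d (Ordinal i7) (Ordinal i7).
by rewrite eqxx mulr1n => <-; rewrite !mxE eqxx.
Qed.

Lemma ent_torus_mull c d g i j : (i < 7)%N ->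
  ent (torus_elt c d * g) i j =
  nth 0 [:: c; d / c; c ^+ 2 / d; 1; d / c ^+ 2; c / d; c^-1] i * ent g i j.
Proof. by move=> i7; rewrite /ent torus_eltMl inordK // torus_weightE. Qed.

Lemma ent_torus_mulr c d g i j : (j < 7)%N ->
  ent (g * torus_elt c d) i j =
  ent g i j * nth 0 [:: c; d / c; c ^+ 2 / d; 1; d / c ^+ 2; c / d; c^-1] j.
Proof. by move=> j7; rewrite /ent torus_eltMr inordK // torus_weightE. Qed.

Lemma octonion_autM g h : octonion_aut g -> octonion_aut h -> octonion_aut (g * h).
Proof. by case: (octonion_aut_subgroup F) => _ _ + _; apply. Qed.

(** The three vanishing entries are the coordinates of the short roots [R10], [R11] and [R21]. The
    torus and the three long root elements then bring the other five coordinates of [upper_eq1] to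
    those of the identity. *)
Lemma upper_long_decomposition h : octonion_aut h -> band 0 h ->
    ent h 0 1 = 0 -> ent h 0 2 = 0 -> ent h 0 3 = 0 ->
  exists c d a1 a2 a3, [/\ c != 0, d != 0 &
    h = torus_elt c d * root_elt true R01 a1 * root_elt true R31 a2
        * root_elt true R32 a3].
Proof.
move=> hA hU h01 h02 h03; have nz := upper_diag_neq0 hA hU.
(* The diagonal of [torus_elt c d] starts with [c] and [d / c]. *)
set c := ent h 0 0; set d := c * ent h 1 1.
have c0 : c != 0 by apply: nz.
have d0 : d != 0 by rewrite mulf_neq0 // nz.
have step x k : octonion_aut x -> band 0 x -> octonion_aut k /\ band 0 k ->
    octonion_aut (x * k) /\ band 0 (x * k).
  by move=> xA xU [kA kU]; split; [apply: octonion_autM | apply: (@bandM _ _ 0 0)].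
have tA := torus_octonion_aut (invr_neq0 c0) (invr_neq0 d0).
pose k1 := torus_elt c^-1 d^-1 * h.
have [k1A k1U] : octonion_aut k1 /\ band 0 k1.
  by apply: step => //; apply: torus_band0.
have hE : h = torus_elt c d * k1 by rewrite mulrA torus_eltV // mul1r.
have k1e : (ent k1 0 0 = 1) * (ent k1 1 1 = 1) * (ent k1 0 1 = 0) *
    (ent k1 0 2 = 0) * (ent k1 0 3 = 0).
  rewrite /k1 !ent_torus_mull //= h01 h02 h03 !mulr0 -/c mulVf //.
  by do !split => //; rewrite /d; field; rewrite c0 nz.
clearbody k1; have nz1 := upper_diag_neq0 k1A k1U; have Z1 := (band0_entries k1U, k1e).
pose a1 := - ent k1 1 2 / ent k1 2 2.
pose k2 := root_elt true R01 a1 * k1.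
have [k2A k2U] : octonion_aut k2 /\ band 0 k2.
  by apply: step; [apply: root_elt_octonion_aut | apply: root_elt_band0 |].
have k1E : k1 = root_elt true R01 (- a1) * k2.
  by rewrite mulrA -{2}[a1]opprK root_eltN mul1r.
have k2e : (ent k2 0 0 = 1) * (ent k2 1 1 = 1) * (ent k2 0 1 = 0) *
    (ent k2 0 2 = 0) * (ent k2 0 3 = 0) * (ent k2 1 2 = 0).
  rewrite /k2 !row_R01 //= !Z1 mulr0 addr0; do !split => //.
  by rewrite /a1; field; rewrite nz1.
clearbody k2; have nz2 := upper_diag_neq0 k2A k2U; have Z2 := (band0_entries k2U, k2e).
pose a2 := - ent k2 0 4 / (6 * ent k2 4 4).
pose k3 := root_elt true R31 a2 * k2.
have [k3A k3U] : octonion_aut k3 /\ band 0 k3.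
  by apply: step; [apply: root_elt_octonion_aut | apply: root_elt_band0 |].
have k2E : k2 = root_elt true R31 (- a2) * k3.
  by rewrite mulrA -{2}[a2]opprK root_eltN mul1r.
have k3e : (ent k3 0 0 = 1) * (ent k3 1 1 = 1) * (ent k3 0 1 = 0) *
    (ent k3 0 2 = 0) * (ent k3 0 3 = 0) * (ent k3 1 2 = 0) * (ent k3 0 4 = 0).
  rewrite /k3 !row_R31 //= !Z2 !mulr0 !addr0; do !split => //.
  by rewrite /a2; field; rewrite nz2.
clearbody k3; have nz3 := upper_diag_neq0 k3A k3U; have Z3 := (band0_entries k3U, k3e).
pose a3 := ent k3 0 5 / (6 * ent k3 5 5).
pose k4 := root_elt true R32 a3 * k3.
have [k4A k4U] : octonion_aut k4 /\ band 0 k4.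
  by apply: step; [apply: root_elt_octonion_aut | apply: root_elt_band0 |].
have k3E : k3 = root_elt true R32 (- a3) * k4.
  by rewrite mulrA -{2}[a3]opprK root_eltN mul1r.
have k4E : k4 = 1.
  apply: upper_eq1; rewrite // /k4 row_R32 //= ?Z3 ?mulr0 ?subr0 //.
  by rewrite /a3; field; rewrite nz3.
exists c, d, (- a1), (- a2), (- a3); split=> //.
by rewrite hE k1E k2E k3E k4E mulr1 !mulrA.
Qed.

(** Short root elements clear columns 1, 2 and 3 of row 0, by increasing height of the root: each
    step keeps the zeros already made, and what remains is a product of torus and long root
    elements. *)
Lemma upper_std_borel h : octonion_aut h -> band 0 h -> std_borel F h.
Proof.
move=> hA hU; have [sB _] := std_borel_octonion_aut F.
have step r c k : octonion_aut k /\ band 0 k ->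
    octonion_aut (root_elt true r c * k) /\ band 0 (root_elt true r c * k).
  move=> [kA kU]; split; first exact/octonion_autM/kA/root_elt_octonion_aut.
  by apply: (@bandM _ _ 0 0) => //; apply: root_elt_band0.
have nz := upper_diag_neq0 hA hU; have Z := band0_entries hU.
apply: (subgroup_mulKl sB (std_borel_root R10 (- ent h 0 1 / ent h 1 1))).
set k1 := _ * h; have [k1A k1U] : octonion_aut k1 /\ band 0 k1 by apply: step.
have k01 : ent k1 0 1 = 0 by rewrite /k1 row_R10 //=; field; rewrite nz.
clearbody k1; have {nz Z} nz := upper_diag_neq0 k1A k1U; have Z := band0_entries k1U.
apply: (subgroup_mulKl sB (std_borel_root R11 (- ent k1 0 2 / ent k1 2 2))).
set k2 := _ * k1; have [k2A k2U] : octonion_aut k2 /\ band 0 k2 by apply: step.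
have k201 : ent k2 0 1 = 0 by rewrite /k2 row_R11 //= k01 Z mulr0 addr0.
have k202 : ent k2 0 2 = 0 by rewrite /k2 row_R11 //=; field; rewrite nz.
clearbody k2; have {nz Z} nz := upper_diag_neq0 k2A k2U; have Z := band0_entries k2U.
apply: (subgroup_mulKl sB (std_borel_root R21 (ent k2 0 3 / (4 * ent k2 3 3)))).
set k3 := _ * k2; have [k3A k3U] : octonion_aut k3 /\ band 0 k3 by apply: step.
have [||| c [d [a1 [a2 [a3 [c0 d0 ->]]]]]] := upper_long_decomposition k3A k3U.
- by rewrite /k3 row_R21 //= !Z k201 !mulr0 addr0 subr0.
- by rewrite /k3 row_R21 //= !Z k202 !mulr0 addr0 subr0.
- by rewrite /k3 row_R21 //= !Z mulr0 addr0; field; rewrite nz.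
have [_ _ BM _] := sB; do 3?apply: (BM); try exact: std_borel_root.
exact: std_borel_torus.
Qed.

(** The kernel of the multiplication by e_0 is the span of e_0, e_1 and e_2, so an automorphism that
    stabilizes the line of e_0 stabilizes this space too. *)
Lemma column0_kernel h : octonion_aut h ->
    (forall i, (0 < i < 7)%N -> ent h i 0 = 0) ->
  forall i j, (0 < j < 3)%N -> (2 < i < 7)%N -> ent h i j = 0.
Proof.
move=> hA h0.
have Z : (ent h 1 0 = 0) * (ent h 2 0 = 0) * (ent h 3 0 = 0) * (ent h 4 0 = 0) *
  (ent h 5 0 = 0) * (ent h 6 0 = 0) by do !split; apply: h0.
have nz : ent h 0 0 != 0.
  have E : ent h 0 0 * ent h 6 6 = 1.
    by linear_in (1 : F) (octonion_aut_form hA (a := 0%N) (b := 6%N) isT isT) Z.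
  by apply: contra_eq_neq E => ->; rewrite mul0r eq_sym oner_neq0.
have cross i b := octonion_aut_cross hA (i := i) (a := 0%N) (b := b).
have K j : (0 < j < 3)%N -> (ent h 3 j = 0) * (ent h 4 j = 0) *
    (ent h 5 j = 0) * (ent h 6 j = 0).
  case: j => [|[|[|]]] // _; do !split; apply: (mulfI nz).
  - by linear_in (2^-1 : F) (cross 0%N 1%N isT isT isT) Z.
  - by linear_in (2^-1 : F) (cross 1%N 1%N isT isT isT) Z.
  - by linear_in (2^-1 : F) (cross 2%N 1%N isT isT isT) Z.
  - by linear_in (1 : F) (cross 3%N 1%N isT isT isT) Z.
  - by linear_in (2^-1 : F) (cross 0%N 2%N isT isT isT) Z.
  - by linear_in (2^-1 : F) (cross 1%N 2%N isT isT isT) Z.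
  - by linear_in (2^-1 : F) (cross 2%N 2%N isT isT isT) Z.
  - by linear_in (1 : F) (cross 3%N 2%N isT isT isT) Z.
by move=> i j /K Kj; case: i => [|[|[|[|[|[|[|]]]]]]] // _; rewrite Kj.
Qed.

(** By [column0_kernel] the flag can fail only at the plane of e_0 and e_1. The root elements of
    [R01] of both signs act on the span of e_1 and e_2; they supply a nonzero pivot at (1,1) and
    clear the entry (2,1), after which [h] is upper triangular. *)
Lemma stab1_P1 h : octonion_aut h ->
  (forall i, (0 < i < 7)%N -> ent h i 0 = 0) -> P1 F h.
Proof.
have [sP PA] := P1_octonion_aut F.
have PN01 c : P1 F (root_elt false R01 c).
  by apply: sub_generated; right; apply: root_subgroup_elt.
have P01 c : P1 F (root_elt true R01 c) by apply: std_borel_P1; apply: std_borel_root.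
wlog h11 : h / ent h 1 1 != 0.
  move=> main hA h0; have [h11|] := eqVneq (ent h 1 1) 0; last by move/main; apply.
  have K := column0_kernel hA h0.
  have Z : (ent h 1 0 = 0) * (ent h 2 0 = 0) * (ent h 3 0 = 0) * (ent h 4 0 = 0) *
    (ent h 5 0 = 0) * (ent h 6 0 = 0) by do !split; apply: h0.
  have form a b := octonion_aut_form hA (a := a) (b := b).
  apply: (subgroup_mulKl sP (P01 1)); apply: main.
  (* Otherwise column 1 would be a multiple of column 0. This contradicts the form: column 5 is
     orthogonal to column 0, but its pairing with column 1 is -1. *)
  - rewrite row_R01 //= h11 add0r mul1r; apply/eqP => h21.
    have h65 : ent h 0 0 * ent h 6 5 = 0.
      by linear_in (1 : F) (form 0%N 5%N isT isT) Z.
    have h00 : ent h 0 0 * ent h 6 6 = 1.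
      by linear_in (1 : F) (form 0%N 6%N isT isT) Z.
    have /eqP : (1 : F) = 0.
      rewrite -[LHS]mul1r -{1}h00 mulrAC.
      have Z' := (Z, h11, h21, K 3 1%N isT isT, K 4 1%N isT isT,
                  K 5 1%N isT isT, K 6 1%N isT isT).
      have h65' : ent h 0 1 * ent h 6 5 = -1.
        by linear_in (1 : F) (form 1%N 5%N isT isT) Z'.
      have -> : ent h 0 0 * 1 * ent h 6 6
        = - (ent h 0 1 * (ent h 0 0 * ent h 6 5)) * ent h 6 6.
        by rewrite mulrCA h65' mulrN1 opprK mulr1.
      by rewrite h65 mulr0 oppr0 mul0r.
    by rewrite oner_eq0.
  - exact/octonion_autM/hA/root_elt_octonion_aut.
  - move=> i /andP[i0 i7]; rewrite row_R01 //.
    by case: i i0 i7 => [|[|[|[|[|[|[|]]]]]]] //= _ _; rewrite !Z ?mulr0 ?addr0.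
move=> hA h0; apply: (subgroup_mulKl sP (PN01 (- ent h 2 1 / ent h 1 1))).
set k := _ * h.
have kA : octonion_aut k by apply/octonion_autM/hA/root_elt_octonion_aut.
have Z : (ent h 1 0 = 0) * (ent h 2 0 = 0) * (ent h 3 0 = 0) * (ent h 4 0 = 0) *
  (ent h 5 0 = 0) * (ent h 6 0 = 0) by do !split; apply: h0.
have k0 i : (0 < i < 7)%N -> ent k i 0 = 0.
  move=> /andP[i0 i7]; rewrite /k row_N01 //.
  by case: i i0 i7 => [|[|[|[|[|[|[|]]]]]]] //= _ _; rewrite !Z ?mulr0 ?addr0.
have K := column0_kernel kA k0.
apply: std_borel_P1; apply: upper_std_borel => //.
apply: flag_upper => // i [|[|[|]]] //= _.
- exact: k0.
- case/andP; case: i => [|[|[|i]]] // _ i7; last exact: K.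
  by rewrite /k row_N01 //=; field.
- by move=> ?; apply: K.
Qed.

(** The root elements of [R10] of both signs act on the stable plane and bring the image of e_0 back
    to its line. The third step of the flag then comes from [column0_kernel]. *)
Lemma stab2_P2 h : octonion_aut h ->
  (forall i j, (j < 2)%N -> (1 < i < 7)%N -> ent h i j = 0) -> P2 F h.
Proof.
have [sP PA] := P2_octonion_aut F.
have PN10 c : P2 F (root_elt false R10 c).
  by apply: sub_generated; right; apply: root_subgroup_elt.
have P10 c : P2 F (root_elt true R10 c) by apply: std_borel_P2; apply: std_borel_root.
wlog h00 : h / ent h 0 0 != 0.
  move=> main hA h0; have [h00|] := eqVneq (ent h 0 0) 0; last by move/main; apply.
  have Z j : (j < 2)%N -> (ent h 2 j = 0) * (ent h 3 j = 0) * (ent h 4 j = 0) *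
    (ent h 5 j = 0) * (ent h 6 j = 0) by move=> j2; do !split; apply: h0.
  have Z0 := Z 0%N isT.
  apply: (subgroup_mulKl sP (P10 1)); apply: main.
  - rewrite row_R10 //= h00 add0r mul1r.
    have E : ent h 1 0 * ent h 5 6 = -1.
      by linear_in (-1 : F) (octonion_aut_form hA (a := 0%N) (b := 6%N) isT isT)
        (Z0, h00).
    by apply: contra_eq_neq E => ->; rewrite mul0r eq_sym oppr_eq0 oner_neq0.
  - exact/octonion_autM/hA/root_elt_octonion_aut.
  - move=> i j j2 /andP[i1 i7]; rewrite row_R10 //; last exact: leq_trans j2 _.
    by case: i i1 i7 => [|[|[|[|[|[|[|]]]]]]] //= _ _; rewrite !(Z _ j2) ?mulr0 ?addr0.
move=> hA h0; apply: (subgroup_mulKl sP (PN10 (- ent h 1 0 / ent h 0 0))).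
set k := _ * h.
have kA : octonion_aut k by apply/octonion_autM/hA/root_elt_octonion_aut.
have Z j : (j < 2)%N -> (ent h 2 j = 0) * (ent h 3 j = 0) * (ent h 4 j = 0) *
  (ent h 5 j = 0) * (ent h 6 j = 0) by move=> j2; do !split; apply: h0.
have k2 i j : (j < 2)%N -> (1 < i < 7)%N -> ent k i j = 0.
  move=> j2 /andP[i1 i7]; rewrite row_N10 //; last exact: leq_trans j2 _.
  by case: i i1 i7 => [|[|[|[|[|[|[|]]]]]]] //= _ _; rewrite !(Z _ j2) ?mulr0 ?addr0.
have k0 i : (0 < i < 7)%N -> ent k i 0 = 0.
  case: i => [|[|i]] // i7; last exact: k2.
  by rewrite /k row_N10 //=; field.
have K := column0_kernel kA k0.
apply: std_borel_P2; apply: upper_std_borel => //.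
apply: flag_upper => // i [|[|[|]]] //= _.
- exact: k0.
- exact: k2.
- by move=> ?; apply: K.
Qed.

End Reduction.

(** * The Borel subgroup of the long root subgroup *)

Section BorelOfA2.
Variable F : numFieldType.
Local Notation M := 'M[F]_7.
Implicit Types (g h x y : M) (c d : F).

Definition A2_borel : set M := [set h : M | A2_long F h /\ band 0 h].

Lemma A2_borel_octonion_aut h : A2_borel h -> octonion_aut h.
Proof. by have [_ AA] := A2_long_octonion_aut F; case=> /AA. Qed.

Lemma band0V g : g \is a GRing.unit -> band 0 g -> band 0 g^-1.
Proof.
move=> ug g0 i j ji; have := band0_stab i ug g0.
have [_ _ _ sV] := @stab_subgroup F 6 i.
by move=> /sV[_]; apply; rewrite ji leqnn.
Qed.

Lemma A2_borel_subgroup : is_subgroup A2_borel.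
Proof.
have [[uA A1 AM AV] _] := A2_long_octonion_aut F; split.
- by move=> g [/uA].
- by split=> //; apply: band1.
- by move=> g h [Ag g0] [Ah h0]; split; [apply: AM | apply: (@bandM _ _ 0 0)].
- by move=> g [Ag g0]; split; [apply: AV | apply: band0V => //; apply: uA].
Qed.

Lemma ent_coloured h i j : coloured h -> (i < 7)%N -> (j < 7)%N ->
  colour i != colour j -> ent h i j = 0.
Proof. by move=> hc i7 j7 ij; apply: hc; rewrite !inordK. Qed.

Lemma A2_borel_torus c d : c != 0 -> d != 0 -> A2_borel (torus_elt c d).
Proof. by move=> c0 d0; split; [apply: A2_long_torus | apply: torus_band0]. Qed.

Lemma A2_borel_root r c : is_long r -> A2_borel (root_elt true r c).
Proof. by move=> rl; split; [apply: A2_long_root | apply: root_elt_band0]. Qed.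

(** The short root entries (0,1), (0,2) and (0,3) join different summands, hence vanish on
    [A2_long]. *)
Lemma A2_borel_decomposition h : A2_borel h -> exists c d a1 a2 a3,
  [/\ c != 0, d != 0 & h = torus_elt c d * root_elt true R01 a1
        * root_elt true R31 a2 * root_elt true R32 a3].
Proof.
move=> Bh; have hA := A2_borel_octonion_aut Bh; case: Bh => [/A2_long_coloured hc h0].
by apply: upper_long_decomposition => //; apply: ent_coloured.
Qed.

Lemma A2_borel_closed : zclosed_in (A2_long F) A2_borel.
Proof.
split; first by move=> h [].
exists [set p | exists i j : 'I_7, (j < i)%N /\ p = entry_poly F i j].
apply/seteqP; split=> h [Ah h0]; split=> //.
  by move=> _ [i [j [ji ->]]]; rewrite -/(mxeval _ _) mxeval_entry h0.
move=> i j ji; have := h0 (entry_poly F i j); rewrite -/(mxeval _ _) mxeval_entry.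
by apply; exists i, j.
Qed.

Lemma root_elt0 s r : root_elt s r 0 = 1 :> M.
Proof. by rewrite root_eltE expr0n mul0r !scale0r !addr0. Qed.

Lemma regular_root_elt (q : {poly F}) s r a :
  regular_curve q (fun t => root_elt s r (t * a) : M).
Proof.
move=> i j.
have rl (b : F) : regular_off q (fun t => t * b).
  by apply: regular_offM (regular_off_cst _ _); exists 0%N, 'X => t _;
       rewrite mul1r hornerX.
have -> : (fun t => root_elt s r (t * a) i j) = (fun t =>
    (1 : M) i j + (t * a * root_vector F s r i j
      + t * a * (t * a) * ((root_vector F s r * root_vector F s r) i j / 2))).
  apply/funext => t; rewrite root_eltE.
  have E (x y z : M) (b d : F) :
      (x + b *: y + d *: z) i j = x i j + (b * y i j + d * z i j).
    by rewrite !mxE addrA.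
  by rewrite E; congr (_ + (_ + _)); field.
apply: regular_offD (regular_off_cst _ _) _.
apply: regular_offD; apply: regular_offM (regular_off_cst _ _); first exact: rl.
by apply: regular_offM; apply: rl.
Qed.

(** The curve is [x] times a path from 1 to [x^-1 * y]. On the factorization of the latter, the root
    parameters are scaled by [t], and the torus parameters follow the affine paths [u] and [v] from
    1 to [c] and [d]; these may pass through 0, hence the restriction to [q = u * v] nonzero. *)
Lemma A2_borel_connected : zconnected A2_borel.
Proof.
have [uB B1 BM BV] := A2_borel_subgroup.
apply: zconnected_curve => x y Bx By.
have [c [d [a1 [a2 [a3 [c0 d0 zE]]]]]] := A2_borel_decomposition (BM _ _ (BV _ Bx) By).
pose u : {poly F} := 1 + (c - 1)%:P * 'X; pose v : {poly F} := 1 + (d - 1)%:P * 'X.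
have uE t : u.[t] = 1 + (c - 1) * t by rewrite /u hornerD hornerM !hornerC hornerX.
have vE t : v.[t] = 1 + (d - 1) * t by rewrite /v hornerD hornerM !hornerC hornerX.
pose q := u * v.
exists q, (fun t => x * (torus_elt u.[t] v.[t] * root_elt true R01 (t * a1)
  * root_elt true R31 (t * a2) * root_elt true R32 (t * a3))).
have qE t : q.[t] = u.[t] * v.[t] by rewrite hornerM.
have [u0 v0] : u.[0] = 1 /\ v.[0] = 1 by rewrite uE vE !mulr0 addr0.
have [u1 v1] : u.[1] = c /\ v.[1] = d by rewrite uE vE !mulr1 ![1 + _]addrC !subrK.
split.
- by rewrite qE u0 v0 mulr1 oner_neq0.
- by rewrite qE u1 v1 mulf_neq0.
- have ru : regular_off q (fun t => u.[t]) by apply: regular_off_horner.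
  have rv : regular_off q (fun t => v.[t]) by apply: regular_off_horner.
  have ruV : regular_off q (fun t => u.[t]^-1).
    exists 1%N, v => t; rewrite qE mulf_eq0 negb_or => /andP[ut _].
    by rewrite expr1 mulrAC divff ?mul1r.
  have rvV : regular_off q (fun t => v.[t]^-1).
    exists 1%N, u => t; rewrite qE mulf_eq0 negb_or => /andP[_ vt].
    by rewrite expr1 mulfK.
  apply: regular_curveM; first by move=> i j; apply: regular_off_cst.
  do 3?[apply: regular_curveM; last exact: regular_root_elt].
  move=> i j.
  have -> : (fun t => torus_elt u.[t] v.[t] i j) =
            (fun t => torus_weight u.[t] v.[t] i * (i == j)%:R).
    by apply/funext => t; rewrite torus_eltE mulr_natr.
  apply: regular_offM (regular_off_cst _ _).
  have -> : (fun t => torus_weight u.[t] v.[t] i) = (fun t => nth 0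
    [:: u.[t]; v.[t] * u.[t]^-1; u.[t] * u.[t] * v.[t]^-1; 1;
        v.[t] * (u.[t]^-1 * u.[t]^-1); u.[t] * v.[t]^-1; u.[t]^-1] i).
    by apply/funext => t; rewrite torus_weightE // !expr2 invfM.
  by case: i => [] [|[|[|[|[|[|[|]]]]]]] //= _; do 2?[apply: regular_offM => //];
    try exact: regular_off_cst.
- rewrite u0 v0 u1 v1 !mul0r !mul1r !root_elt0 torus_elt1 !mulr1 -zE mulVKr //.
  exact: uB.
- move=> t; rewrite qE mulf_eq0 negb_or => /andP[ut vt].
  apply: (BM) => //; do 3?[apply: (BM); last exact: A2_borel_root].
  exact: A2_borel_torus.
Qed.

(** The action on the summand of colour 0, a natural 3-dimensional representation of the subgroup of
    type A_2; the order 0, 4, 5 keeps upper triangular matrices upper triangular. *)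
Definition long_block g : 'M[F]_3 :=
  \matrix_(i, j) ent g (nth 0 [:: 0; 4; 5] i)%N (nth 0 [:: 0; 4; 5] j)%N.

Lemma long_blockM g h : coloured g -> coloured h ->
  long_block (g * h) = long_block g * long_block h.
Proof.
move=> gc hc; have Z (i : 'I_3) j : j \in [:: 1; 2; 3; 6]%N ->
    ent g (nth 0 [:: 0; 4; 5] i)%N j = 0.
  rewrite !inE => j4; apply: ent_coloured => //.
  - by case: i => [] [|[|[|]]].
  - by case/or4P: j4 => /eqP ->.
  - by case/or4P: j4 => /eqP ->; case: i => [] [|[|[|]]].
apply/matrixP => i j; rewrite [RHS]mxE !big_ord_recl big_ord0 addr0.
have E (A : M) (a b : 'I_3) : long_block A a b =
    ent A (nth 0 [:: 0; 4; 5] a)%N (nth 0 [:: 0; 4; 5] b)%N by rewrite mxE.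
by rewrite !E entM (Z _ 1%N) // (Z _ 2) // (Z _ 3) // (Z _ 6) // !mul0r !addr0 /= addrA.
Qed.

Lemma long_block1 : long_block 1 = 1.
Proof.
by apply/matrixP => i j; rewrite mxE; case: i => [] [|[|[|]]] //= ?;
   case: j => [] [|[|[|]]] //= ?; rewrite ent1 // mxE.
Qed.

(** On e_0, e_4, e_5 the elements of parameter s for [R01], [R31] and [R32] are the elementary
    transvections in positions (1,2), (0,1) and (0,2) with parameters s, 6 s and -6 s. *)
Lemma unitriangular_long_block (u : 'M[F]_3) : band 1 (u - 1) ->
  exists2 h, A2_borel h & u = long_block h.
Proof.
pose tri (k : M) (a b c : F) := forall i j, (i < 3)%N -> (j < 3)%N ->
  ent k (nth 0 [:: 0; 4; 5] i)%N (nth 0 [:: 0; 4; 5] j)%N =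
  nth 0 (nth [::] [:: [:: 1; b; c]; [:: 0; 1; a]; [:: 0; 0; 1]] i) j.
have triE k a b c : tri k a b c ->
    (ent k 0 0 = 1) * (ent k 0 4 = b) * (ent k 0 5 = c) * (ent k 4 0 = 0) *
    (ent k 4 4 = 1) * (ent k 4 5 = a) * (ent k 5 0 = 0) * (ent k 5 4 = 0) *
    (ent k 5 5 = 1).
  move=> kT; do !split.
  - exact: (kT 0 0)%N.
  - exact: (kT 0 1)%N.
  - exact: (kT 0 2)%N.
  - exact: (kT 1 0)%N.
  - exact: (kT 1 1)%N.
  - exact: (kT 1 2)%N.
  - exact: (kT 2 0)%N.
  - exact: (kT 2 1)%N.
  - exact: (kT 2 2)%N.
have tri1 : tri 1 0 0 0.
  by move=> [|[|[|i]]] [|[|[|j]]] // _ _; rewrite ent1.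
have tri01 k a b c s : tri k a b c -> tri (root_elt true R01 s * k) (a + s) b c.
  move=> /triE kE [|[|[|i]]] [|[|[|j]]] // _ _; rewrite /= row_R01 //= !kE; ring.
have tri31 k a b c s : tri k a b c ->
    tri (root_elt true R31 s * k) a (b + 6 * s) (c + 6 * s * a).
  move=> /triE kE [|[|[|i]]] [|[|[|j]]] // _ _; rewrite /= row_R31 //= !kE; ring.
have tri32 k a b c s : tri k a b c -> tri (root_elt true R32 s * k) a b (c - 6 * s).
  move=> /triE kE [|[|[|i]]] [|[|[|j]]] // _ _; rewrite /= row_R32 //= !kE; ring.
have blockE a b c : exists2 k, A2_borel k & tri k a b c.
  (* [R31] acts before [R01], while the entry [a] is still 0, so the cross term of [tri31]
     vanishes. *)
  have := tri01 _ _ _ _ a (tri31 _ _ _ _ (b / 6) (tri32 _ _ _ _ (- (c / 6)) tri1)).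
  have -> : 0 + a = a by ring.
  have -> : 0 + 6 * (b / 6) = b by field.
  have -> : 0 - 6 * - (c / 6) + 6 * (b / 6) * 0 = c by field.
  move=> kT; eexists; last exact: kT.
  have [_ B1 BM _] := A2_borel_subgroup.
  by do 3?[apply: (BM); first exact: A2_borel_root].
move=> u1; have uE (k l : nat) : (k < 3)%N -> (l <= k)%N ->
    u (inord k) (inord l) = (k == l)%:R.
  move=> k3 lk; have l3 : (l < 3)%N by apply: leq_ltn_trans k3.
  apply/eqP; rewrite -subr_eq0; have := u1 (inord k) (inord l).
  by rewrite !mxE -val_eqE /= !inordK // add1n ltnS => ->.
pose o (k : nat) : 'I_3 := inord k.
have [k Bk kT] := blockE (u (o 1%N) (o 2)) (u (o 0%N) (o 1%N)) (u (o 0%N) (o 2)).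
exists k => //; apply/matrixP => i j; rewrite mxE kT //.
rewrite -[i in LHS]inord_val -[j in LHS]inord_val.
by case: i j => [] [|[|[|]]] //= _ [] [|[|[|]]] //= _; rewrite ?uE.
Qed.

(** The image of [K] on the summand of colour 0 is solvable and contains all unitriangular matrices,
    so it is triangular. The form pairs this summand with that of colour 1, on which [h] is thereby
    triangular as well. *)
Lemma A2_borel_maximal K : is_subgroup K -> K `<=` A2_long F ->
  solvable_group K -> A2_borel `<=` K -> K `<=` A2_borel.
Proof.
move=> sK KA solK BK h Kh; split; first exact: KA.
have Kc g : K g -> coloured g by move=> /KA/A2_long_coloured.
have [_ AA] := A2_long_octonion_aut F; have hA := AA _ (KA _ Kh).
have blockM g x : K g -> K x -> long_block (g * x) = long_block g * long_block x.
  by move=> /Kc gc /Kc xc; apply: long_blockM.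
have hb : band 0 (long_block h).
  apply: (@solvable_upper _ _ (long_block @` K)); last by exists h.
  - exact: (morph_subgroup sK long_block1 blockM sK).
  - by move=> u /unitriangular_long_block[g /BK Kg ->]; exists g.
  - exact: (morph_solvable sK long_block1 blockM solK).
have b i j : (j < i < 3)%N ->
    ent h (nth 0 [:: 0; 4; 5] i)%N (nth 0 [:: 0; 4; 5] j)%N = 0.
  move=> /andP[ji i3]; have j3 := ltn_trans ji i3.
  by have := hb (inord i) (inord j); rewrite mxE !inordK // add0n => ->.
have hc := Kc _ Kh.
have Z0 : (ent h 1 0 = 0) * (ent h 2 0 = 0) * (ent h 3 0 = 0) * (ent h 4 0 = 0) *
  (ent h 5 0 = 0) * (ent h 6 0 = 0) * (ent h 3 1 = 0) * (ent h 4 1 = 0) *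
  (ent h 5 1 = 0) * (ent h 3 2 = 0) * (ent h 4 2 = 0) * (ent h 5 2 = 0) *
  (ent h 0 1 = 0) * (ent h 0 2 = 0) * (ent h 6 4 = 0) * (ent h 5 4 = 0).
  by do !split; do ?[by apply: ent_coloured];
     [exact: (b 1%N 0%N) | exact: (b 2 0%N) | exact: (b 2 1%N)].
have form i j := octonion_aut_form hA (a := i) (b := j).
have n00 : ent h 0 0 != 0.
  have E : ent h 0 0 * ent h 6 6 = 1 by linear_in (1 : F) (form 0%N 6%N isT isT) Z0.
  by apply: contra_eq_neq E => ->; rewrite mul0r eq_sym oner_neq0.
have h61 : ent h 6 1 = 0.
  by apply: (mulfI n00); linear_in (1 : F) (form 0%N 1%N isT isT) Z0.
have h62 : ent h 6 2 = 0.
  by apply: (mulfI n00); linear_in (1 : F) (form 0%N 2%N isT isT) Z0.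
have n44 : ent h 4 4 != 0.
  have E : ent h 4 4 * ent h 2 2 = 1.
    by linear_in (1 : F) (form 2%N 4%N isT isT) (Z0, h62).
  by apply: contra_eq_neq E => ->; rewrite mul0r eq_sym oner_neq0.
have h21 : ent h 2 1 = 0.
  by apply: (mulfI n44); linear_in (1 : F) (form 1%N 4%N isT isT) (Z0, h61).
have Z := (Z0, h61, h62, h21).
apply: flag_upper => // i j.
by case: j => [|[|[|]]] // _; case: i => [|[|[|[|[|[|[|]]]]]]] // _; rewrite Z.
Qed.

Lemma A2_borel_Borel : Borel_subgroup (A2_long F) A2_borel.
Proof.
split.
  split.
  - exact: A2_borel_subgroup.
  - exact: A2_borel_closed.
  - exact: A2_borel_connected.
  - by apply: solvable_band0; [exact: A2_borel_subgroup | move=> h []].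
move=> K [sK [KA _] _ solK] BK; apply/seteqP; split=> //.
exact: A2_borel_maximal.
Qed.

End BorelOfA2.

(** * Open orbits *)

Lemma inord0 n : inord 0 = 0 :> 'I_n.+1.
Proof. by apply: val_inj; rewrite /= inordK. Qed.

Section OpenOrbits.
Variable F : numFieldType.
Local Notation M := 'M[F]_7.
Implicit Types (g h x y : M) (c d : F).

(** Each of these indices is the last of its colour, so the diagonal entry is the only nonzero one
    in its row of [b]. *)
Lemma A2_borel_row b g i j : A2_borel b -> i \in [:: 3; 5; 6]%N ->
  ent (b * g) i j = ent b i i * ent g i j /\ ent b i i != 0.
Proof.
rewrite !inE => Bb i356; have bA := A2_borel_octonion_aut Bb.
case: Bb => /A2_long_coloured bc b0; split; last first.
  by apply: upper_diag_neq0 => //; case/or3P: i356 => /eqP ->.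
have Z := band0_entries b0.
have Zc : (ent b 3 4 = 0) * (ent b 3 5 = 0) * (ent b 3 6 = 0) * (ent b 5 6 = 0).
  by do !split; apply: ent_coloured.
by case/or3P: i356 => /eqP ->; rewrite entM !(Z, Zc) !mul0r !(add0r, addr0).
Qed.

Lemma stab1_col g x i : stab 1 x -> ent (g * x) i 0 = ent g i 0 * ent x 0 0.
Proof. by move=> sx; rewrite /ent inord0 stab1_mul. Qed.

Definition minor g (a b : nat) : F := ent g a 0 * ent g b 1 - ent g b 0 * ent g a 1.

Lemma stab2_col g x i j : stab 2 x -> (j < 2)%N ->
  ent (g * x) i j = ent g i 0 * ent x 0 j + ent g i 1 * ent x 1 j.
Proof.
move=> [_ sx] j2; have Z k : (1 < k < 7)%N -> ent x k j = 0.
  move=> /andP[k1 k7]; apply: sx.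
  by rewrite !inordK // ?j2 // (ltn_trans j2).
by rewrite entM (Z 2) // (Z 3) // (Z 4) // (Z 5) // (Z 6) // !mulr0 !addr0.
Qed.

Lemma stab2_minor g x a b : stab 2 x -> minor (g * x) a b = minor g a b * minor x 0 1.
Proof. by move=> sx; rewrite /minor !stab2_col //; ring. Qed.

Lemma stab2_minor_neq0 x : stab 2 x -> minor x 0 1 != 0.
Proof.
move=> sx; have [ux _] := sx; have : minor (x^-1 * x) 0 1 != 0.
  by rewrite mulVr // /minor !ent1 //= mulr0 subr0 mulr1 oner_neq0.
by rewrite stab2_minor // mulf_eq0 negb_or => /andP[].
Qed.

Lemma A2_borel_minor b g i j : A2_borel b -> 
    i \in [:: 3; 5; 6]%N -> j \in [:: 3; 5; 6]%N ->
  minor (b * g) i j = ent b i i * ent b j j * minor g i j.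
Proof.
move=> Bb i3 j3; have R k l k3 := (@A2_borel_row b g k l Bb k3).1.
by rewrite /minor !R //; ring.
Qed.

(** Rows 5 and 6 serve as pivots: [R01] clears row 4 with row 5, then [R31] and [R32] clear rows 2
    and 1 with row 6. *)
Lemma P1_normal_form g : octonion_aut g ->
    ent g 3 0 != 0 -> ent g 5 0 != 0 -> ent g 6 0 != 0 ->
  exists b x, [/\ A2_borel b, P1 F x & forall i, (i < 7)%N ->
    ent (b * g * x) i 0 = nth 0 [:: 1; 0; 0; 1; 0; 1; 1] i].
Proof.
have [_ _ BM _] := A2_borel_subgroup F.
move=> gA g3 g5 g6.
(* Right multiplication by [x] below divides column 0 by [ent g 3 0]. The left torus fixes row 3 and
   scales rows 5 and 6 by [c / d] and [c^-1]; these values turn all three entries into 1. *)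
set c := ent g 6 0 / ent g 3 0; set d := ent g 6 0 * ent g 5 0 / ent g 3 0 ^+ 2.
have [c0 d0] : c != 0 /\ d != 0 by rewrite !mulf_neq0 ?invr_neq0 ?expf_neq0.
set x := torus_elt (ent g 3 0)^-1 1.
have xA : octonion_aut x by apply: torus_octonion_aut; rewrite ?invr_neq0 ?oner_neq0.
have Px : P1 F x.
  by apply: std_borel_P1; apply: std_borel_torus; rewrite ?invr_neq0 ?oner_neq0.
pose k1 := torus_elt c d * (g * x).
have k1A : octonion_aut k1.
  by apply: octonion_autM; [apply: torus_octonion_aut | apply: octonion_autM].
have e1 : (ent k1 3 0 = 1) * (ent k1 5 0 = 1) * (ent k1 6 0 = 1).
  rewrite /k1 !ent_torus_mull // !ent_torus_mulr //= /c /d.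
  by do !split; field; rewrite ?g3 ?g5 ?g6.
have k1E : k1 = torus_elt c d * g * x by rewrite /k1 mulrA.
clearbody k1.
pose k2 := root_elt true R01 (- ent k1 4 0) * k1.
have k2A : octonion_aut k2 by apply: octonion_autM => //; apply: root_elt_octonion_aut.
have e2 : (ent k2 3 0 = 1) * (ent k2 5 0 = 1) * (ent k2 6 0 = 1) * (ent k2 4 0 = 0).
  by rewrite /k2 !row_R01 //= !e1 mulr1 subrr.
have k2E : k2 = root_elt true R01 (- ent k1 4 0) * k1 by [].
clearbody k2.
pose k3 := root_elt true R31 (ent k2 2 0 / 6) * k2.
have k3A : octonion_aut k3 by apply: octonion_autM => //; apply: root_elt_octonion_aut.
have e3 : (ent k3 3 0 = 1) * (ent k3 5 0 = 1) * (ent k3 6 0 = 1) * (ent k3 4 0 = 0)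
    * (ent k3 2 0 = 0).
  by rewrite /k3 !row_R31 //= !e2; do !split => //; field.
have k3E : k3 = root_elt true R31 (ent k2 2 0 / 6) * k2 by [].
clearbody k3.
pose k4 := root_elt true R32 (ent k3 1 0 / 6) * k3.
have k4A : octonion_aut k4 by apply: octonion_autM => //; apply: root_elt_octonion_aut.
have e4 : (ent k4 3 0 = 1) * (ent k4 5 0 = 1) * (ent k4 6 0 = 1) * (ent k4 4 0 = 0)
    * (ent k4 2 0 = 0) * (ent k4 1 0 = 0).
  by rewrite /k4 !row_R32 //= !e3; do !split => //; field.
have k4E : k4 = root_elt true R32 (ent k3 1 0 / 6) * k3 by [].
clearbody k4.
(* The vector e_0 is isotropic, hence so is its image v; with the entries found so far the form
   reads 2 v_0 - 2 = 0. *)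
have e40 : ent k4 0 0 = 1.
  by linear_in (2^-1 : F) (octonion_aut_form k4A (a := 0%N) (b := 0%N) isT isT) e4.
exists (root_elt true R32 (ent k3 1 0 / 6) * (root_elt true R31 (ent k2 2 0 / 6) *
  (root_elt true R01 (- ent k1 4 0) * torus_elt c d))), x; split=> //.
  do 3?[apply: (BM); first exact: A2_borel_root].
  exact: A2_borel_torus.
have -> : root_elt true R32 (ent k3 1 0 / 6) * (root_elt true R31 (ent k2 2 0 / 6) *
  (root_elt true R01 (- ent k1 4 0) * torus_elt c d)) * g * x = k4.
  by rewrite k4E k3E k2E k1E !mulrA.
by case=> [|[|[|[|[|[|[|]]]]]]] // _; rewrite /= (e4, e40).
Qed.

(** The root elements of [R10] of both signs, acting on the right, change the basis of the plane
    without changing its minors. Once rows 5 and 6 are diagonal, each of the three minors is up to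
    sign a product of two of the four entries claimed to be nonzero. *)
Lemma P2_normal_form_pivots g : octonion_aut g ->
    minor g 5 6 != 0 -> minor g 3 6 != 0 -> minor g 3 5 != 0 ->
  exists2 x, P2 F x & [/\ ent (g * x) 5 1 = 0, ent (g * x) 6 0 = 0,
    ent (g * x) 5 0 != 0, ent (g * x) 6 1 != 0 &
    ent (g * x) 3 0 != 0 /\ ent (g * x) 3 1 != 0].
Proof.
have [[_ P1 PM _] _] := P2_octonion_aut F.
have PN10 c : P2 F (root_elt false R10 c).
  by apply: sub_generated; right; apply: root_subgroup_elt.
have P10 c : P2 F (root_elt true R10 c) by apply: std_borel_P2; apply: std_borel_root.
move=> gA m56 m36 m35.
have m10 k c a b : (a < 7)%N -> (b < 7)%N ->
    minor (k * root_elt true R10 c) a b = minor k a b.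
  by move=> a7 b7; rewrite /minor !col_R10 //=; ring.
have mN10 k c a b : (a < 7)%N -> (b < 7)%N ->
    minor (k * root_elt false R10 c) a b = minor k a b.
  by move=> a7 b7; rewrite /minor !col_N10 //=; ring.
wlog g61 : g gA m56 m36 m35 / ent g 6 1 != 0.
  move=> main; have [g61|] := eqVneq (ent g 6 1) 0; last exact: main.
  have [||||| x Px xE] := main (g * root_elt true R10 1).
  - by apply: octonion_autM => //; apply: root_elt_octonion_aut.
  - by rewrite m10.
  - by rewrite m10.
  - by rewrite m10.
  - rewrite col_R10 //= g61 add0r mul1r.
    apply: contraNneq m56 => g60.
    by rewrite /minor g61 g60 mulr0 mul0r subrr.
  - by exists (root_elt true R10 1 * x); [apply: PM | rewrite mulrA].
pose k := g * root_elt false R10 (- ent g 6 0 / ent g 6 1).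
have k60 : ent k 6 0 = 0 by rewrite /k col_N10 //=; field.
have k61 : ent k 6 1 != 0 by rewrite /k col_N10.
have [k56 k36 k35] : [/\ minor k 5 6 != 0, minor k 3 6 != 0 & minor k 3 5 != 0].
  by rewrite /k !mN10.
have kE : k = g * root_elt false R10 (- ent g 6 0 / ent g 6 1) by [].
clearbody k.
have k50 : ent k 5 0 != 0.
  by apply: contraNneq k56 => k50; rewrite /minor k50 k60 !mul0r subrr.
exists (root_elt false R10 (- ent g 6 0 / ent g 6 1)
        * root_elt true R10 (- ent k 5 1 / ent k 5 0)); first exact: PM.
rewrite mulrA -kE; set l := k * _.
have l60 : ent l 6 0 = 0 by rewrite /l col_R10.
have l50 : ent l 5 0 != 0 by rewrite /l col_R10.
have l51 : ent l 5 1 = 0 by rewrite /l col_R10 //=; field.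
have l61 : ent l 6 1 != 0 by rewrite /l col_R10 //= k60 mulr0 addr0.
have [l36 l35] : minor l 3 6 != 0 /\ minor l 3 5 != 0 by rewrite /l !m10.
clearbody l; split=> //; split.
  by apply: contraNneq l36 => l30; rewrite /minor l30 l60 !mul0r subrr.
by apply: contraNneq l35 => l31; rewrite /minor l31 l51 !mulr0 subrr.
Qed.

Lemma P2_normal_form g : octonion_aut g ->
    minor g 5 6 != 0 -> minor g 3 6 != 0 -> minor g 3 5 != 0 ->
  exists b x, [/\ A2_borel b, P2 F x & forall i, (i < 7)%N ->
    ent (b * g * x) i 0 = nth 0 [:: 0; -1; -1; 1; 0; 1; 0] i /\
    ent (b * g * x) i 1 = nth 0 [:: 1; -1; 0; 1; -1; 0; 1] i].
Proof.
have [_ _ BM _] := A2_borel_subgroup F.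
have [[_ _ PM _] PA] := P2_octonion_aut F.
move=> gA m56 m36 m35.
have [x Px [z51 z60 n50 n61 [n30 n31]]] := P2_normal_form_pivots gA m56 m36 m35.
pose k0 := g * x; have k0A : octonion_aut k0 by apply: octonion_autM; auto.
rewrite -/k0 in z51 z60 n50 n61 n30 n31.
have k0E : k0 = g * x by [].
clearbody k0.
(* The right torus scales columns 0 and 1 by [c'] and [d' / c'], which makes both entries of row 3
   equal to 1. The left torus fixes row 3, and [c] and [d] below are chosen to make the pivots in
   rows 6 and 5 equal to 1. *)
set c' := (ent k0 3 0)^-1; set d' := (ent k0 3 0 * ent k0 3 1)^-1.
have [c'0 d'0] : c' != 0 /\ d' != 0 by rewrite !invr_neq0 ?mulf_neq0.
set c := ent k0 6 1 / ent k0 3 1.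
set d := c * (ent k0 5 0 / ent k0 3 0).
have [c0 d0] : c != 0 /\ d != 0 by rewrite /d /c !mulf_neq0 ?invr_neq0.
pose k1 := torus_elt c d * (k0 * torus_elt c' d').
have k1A : octonion_aut k1.
  by apply: octonion_autM; [|apply: octonion_autM => //]; apply: torus_octonion_aut.
have e1 : (ent k1 3 0 = 1) * (ent k1 3 1 = 1) * (ent k1 5 0 = 1) * (ent k1 5 1 = 0) *
    (ent k1 6 0 = 0) * (ent k1 6 1 = 1).
  rewrite /k1 !ent_torus_mull // !ent_torus_mulr //= z51 z60 !(mul0r, mulr0).
  rewrite /d /c /c' /d'.
  by do !split; field; rewrite ?n50 ?n61 ?n30 ?n31.
have k1E : k1 = torus_elt c d * g * (x * torus_elt c' d') by rewrite /k1 k0E !mulrA.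
clearbody k1.
pose k2 := root_elt true R01 (- ent k1 4 0) * k1.
have k2A : octonion_aut k2 by apply: octonion_autM => //; apply: root_elt_octonion_aut.
have e2 : (ent k2 3 0 = 1) * (ent k2 3 1 = 1) * (ent k2 5 0 = 1) * (ent k2 5 1 = 0) *
    (ent k2 6 0 = 0) * (ent k2 6 1 = 1) * (ent k2 4 0 = 0).
  by rewrite /k2 !row_R01 //= !e1 mulr1 subrr.
have k2E : k2 = root_elt true R01 (- ent k1 4 0) * k1 by [].
clearbody k2.
pose k3 := root_elt true R31 (ent k2 2 1 / 6) * k2.
have k3A : octonion_aut k3 by apply: octonion_autM => //; apply: root_elt_octonion_aut.
have e3 : (ent k3 3 0 = 1) * (ent k3 3 1 = 1) * (ent k3 5 0 = 1) * (ent k3 5 1 = 0) *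
    (ent k3 6 0 = 0) * (ent k3 6 1 = 1) * (ent k3 4 0 = 0) * (ent k3 2 1 = 0).
  by rewrite /k3 !row_R31 //= !e2; do !split => //; field.
have k3E : k3 = root_elt true R31 (ent k2 2 1 / 6) * k2 by [].
clearbody k3.
pose k4 := root_elt true R32 (ent k3 0 0 / 6) * k3.
have k4A : octonion_aut k4 by apply: octonion_autM => //; apply: root_elt_octonion_aut.
have e4 : (ent k4 3 0 = 1) * (ent k4 3 1 = 1) * (ent k4 5 0 = 1) * (ent k4 5 1 = 0) *
    (ent k4 6 0 = 0) * (ent k4 6 1 = 1) * (ent k4 4 0 = 0) * (ent k4 2 1 = 0) *
    (ent k4 0 0 = 0).
  by rewrite /k4 !row_R32 //= !e3; do !split => //; field.
have k4E : k4 = root_elt true R32 (ent k3 0 0 / 6) * k3 by [].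
clearbody k4.
(* The product of e_0 and e_1 is zero, hence so is that of columns 0 and 1; its coordinates 5, 6, 4,
   3 and 2 yield in turn the five entries still unknown. *)
have cross i := octonion_aut_cross k4A (i := i) (a := 0%N) (b := 1%N).
have e20 : ent k4 2 0 = -1 by linear_in (2^-1 : F) (cross 5 isT isT isT) e4.
have e41 : ent k4 4 1 = -1 by linear_in (2^-1 : F) (cross 6 isT isT isT) (e4, e20).
have e10 : ent k4 1 0 = -1 by linear_in (2^-1 : F) (cross 4 isT isT isT) (e4, e20, e41).
have e11 : ent k4 1 1 = -1.
  by linear_in (-1 : F) (cross 3 isT isT isT) (e4, e20, e41, e10).
have e01 : ent k4 0 1 = 1.
  by linear_in (- 2^-1 : F) (cross 2 isT isT isT) (e4, e20, e41, e10, e11).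
exists (root_elt true R32 (ent k3 0 0 / 6) * (root_elt true R31 (ent k2 2 1 / 6) *
  (root_elt true R01 (- ent k1 4 0) * torus_elt c d))), (x * torus_elt c' d'); split.
- do 3?[apply: (BM); first exact: A2_borel_root].
  exact: A2_borel_torus.
- by apply: (PM) => //; apply: std_borel_P2; apply: std_borel_torus.
have -> : root_elt true R32 (ent k3 0 0 / 6) * (root_elt true R31 (ent k2 2 1 / 6) *
  (root_elt true R01 (- ent k1 4 0) * torus_elt c d)) * g * (x * torus_elt c' d') = k4.
  by rewrite k4E k3E k2E k1E !mulrA.
by case=> [|[|[|[|[|[|[|]]]]]]] // _; rewrite /= !(e4, e20, e41, e10, e11, e01).
Qed.

(** An element of G_2 that lies in both open sets: coordinates 3, 5, 6 of column 0 and the three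
    minors are nonzero on it. *)
Definition base_point : M := root_elt false R11 1 * root_elt false R21 1.

Lemma base_point_entries :
  (ent base_point 3 0 = -2) * (ent base_point 5 0 = 4) * (ent base_point 6 0 = 4) *
  (ent base_point 3 1 = 1) * (ent base_point 5 1 = -1) * (ent base_point 6 1 = 2).
Proof.
rewrite /base_point !entM !ent_root_elt //; eval_roots.
by rewrite /zent /=; do !split; field.
Qed.

(** Normal forms of [g] and [g0] need only agree modulo [P] on the right: they agree in the first
    one or two columns, and no more is prescribed of them. *)
Lemma orbit_of_normal_forms P g g0 b x b0 x0 : is_subgroup P ->
    A2_borel b -> P x -> A2_borel b0 -> P x0 ->
    g0 \is a GRing.unit -> P ((b0 * g0 * x0)^-1 * (b * g * x)) ->
  exists b' x', [/\ A2_borel b', P x' & g = b' * g0 * x'].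
Proof.
have [uB _ BM BV] := A2_borel_subgroup F.
move=> [uP _ PM PV] Bb Px Bb0 Px0 ug0 Pk.
exists (b^-1 * b0), (x0 * ((b0 * g0 * x0)^-1 * (b * g * x)) * x^-1); split.
- by apply: BM => //; apply: BV.
- by apply: (PM); [apply: (PM) | apply: PV].
have [ub ux] := (uB _ Bb, uP _ Px); have [ub0 ux0] := (uB _ Bb0, uP _ Px0).
have uk : b0 * g0 * x0 \is a GRing.unit by rewrite !unitrMl.
have -> : b^-1 * b0 * g0 * (x0 * ((b0 * g0 * x0)^-1 * (b * g * x)) / x) =
  b^-1 * ((b0 * g0 * x0) * ((b0 * g0 * x0)^-1 * (b * g * x))) / x by rewrite !mulrA.
by rewrite mulVKr // !mulrA mulVr // mul1r mulrK.
Qed.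

Lemma ent_mulV_col h k j : h \is a GRing.unit -> (j < 7)%N ->
    (forall i, (i < 7)%N -> ent h i j = ent k i j) ->
  forall i, (i < 7)%N -> ent (h^-1 * k) i j = (i == j)%:R.
Proof. by move=> uh j7 hk i i7; rewrite entM -!hk // -entM mulVr // ent1. Qed.

Lemma base_point_G2 : G2 F base_point.
Proof.
by have [[_ _ GM _] _] := G2_octonion_aut F; apply: GM; apply: G2_root.
Qed.

Lemma A2_borel_sub_G2 : @A2_borel F `<=` G2 F.
Proof.
have [sG _] := G2_octonion_aut F.
move=> h [Ah _]; apply: generated_sub Ah => // x.
move=> [Tx|[s _ [r _ Rx]]]; apply: sub_generated; first by left.
by right; exists s => //; exists r.
Qed.

Lemma mxeval_ent i j (g : M) :
  mxeval (@entry_poly F 6 (inord i) (inord j)) g = ent g i j.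
Proof. by rewrite mxeval_entry. Qed.

Lemma G2_P1_spherical : spherical (G2 F) (P1 F) (A2_long F).
Proof.
have [sG GA] := G2_octonion_aut F; have [sP PA] := P1_octonion_aut F.
have BA h : A2_borel h -> octonion_aut h by apply: A2_borel_octonion_aut.
have G0 := base_point_G2; have A0 := GA _ G0.
pose e i := @entry_poly F 6 (inord i) (inord 0).
refine (spherical_criterion (p := e 3 * e 5 * e 6) sG sP
  (@A2_borel_Borel F) A2_borel_sub_G2 G0 _).
move=> g Gg; have Ag := GA _ Gg.
rewrite /mxeval !mevalM -!/(mxeval _ _) !mxeval_ent !mulf_eq0 !negb_or.
split=> [/andP[/andP[g3 g5] g6]|[b [x [Bb Px ->]]]].
  have [b [x [Bb Px bgx]]] := P1_normal_form Ag g3 g5 g6.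
  have [||| b0 [x0 [Bb0 Px0 bgx0]]] := P1_normal_form A0;
    rewrite ?base_point_entries ?oppr_eq0 ?pnatr_eq0 //.
  have A1 : octonion_aut (b * g * x) by do 2?apply: octonion_autM; auto.
  have A2 : octonion_aut (b0 * base_point * x0) by do 2?apply: octonion_autM; auto.
  have [_ _ AM AV] := octonion_aut_subgroup F.
  (* Both normal forms have the same column 0, so their quotient fixes e_0 and lies in P_1. *)
  apply: (orbit_of_normal_forms sP Bb Px Bb0 Px0 (octonion_aut_unit A0)).
  apply: stab1_P1; first by apply: AM => //; apply: AV.
  move=> i /andP[i0 i7]; rewrite ent_mulV_col ?(octonion_aut_unit A2) //.
    by rewrite gtn_eqF.
  by move=> k k7; rewrite bgx // bgx0.
have sx := P1_stab Px; have x0 := stab_diag_neq0 sx.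
have {}x0 : ent x 0 0 != 0 by rewrite /ent inord0.
have R i i3 := @A2_borel_row b base_point i 0 Bb i3.
have nz i : i \in [:: 3; 5; 6]%N -> ent base_point i 0 != 0 ->
    ent (b * base_point * x) i 0 != 0.
  by move=> i3 bi; have [E bii] := R i i3; rewrite stab1_col // E !mulf_neq0.
by rewrite !nz // base_point_entries ?oppr_eq0 ?pnatr_eq0.
Qed.

Lemma G2_P2_spherical : spherical (G2 F) (P2 F) (A2_long F).
Proof.
have [sG GA] := G2_octonion_aut F; have [sP PA] := P2_octonion_aut F.
have BA h : A2_borel h -> octonion_aut h by apply: A2_borel_octonion_aut.
have G0 := base_point_G2; have A0 := GA _ G0.
pose e i j := @entry_poly F 6 (inord i) (inord j).
pose m i j := e i 0 * e j 1 - e j 0 * e i 1.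
refine (spherical_criterion (p := m 5 6 * m 3 6 * m 3 5) sG sP
  (@A2_borel_Borel F) A2_borel_sub_G2 G0 _).
move=> g Gg; have Ag := GA _ Gg.
have mE i j : mxeval (m i j) g = minor g i j.
  by rewrite /mxeval mevalB !mevalM -!/(mxeval _ _) !mxeval_ent.
rewrite /mxeval !mevalM -!/(mxeval _ _) !mE !mulf_eq0 !negb_or.
have m0 : [/\ minor base_point 5 6 != 0, minor base_point 3 6 != 0 &
              minor base_point 3 5 != 0].
  rewrite /minor !base_point_entries; split.
  - by rewrite (_ : _ - _ = 12) ?pnatr_eq0 //; ring.
  - by rewrite (_ : _ - _ = - 8) ?oppr_eq0 ?pnatr_eq0 //; ring.
  - by rewrite (_ : _ - _ = - 2) ?oppr_eq0 ?pnatr_eq0 //; ring.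
case: m0 => m56 m36 m35.
split=> [/andP[/andP[g3 g5] g6]|[b [x [Bb Px ->]]]].
  have [b [x [Bb Px bgx]]] := P2_normal_form Ag g3 g5 g6.
  have [b0 [x0 [Bb0 Px0 bgx0]]] := P2_normal_form A0 m56 m36 m35.
  have A1 : octonion_aut (b * g * x) by do 2?apply: octonion_autM; auto.
  have A2 : octonion_aut (b0 * base_point * x0) by do 2?apply: octonion_autM; auto.
  have [_ _ AM AV] := octonion_aut_subgroup F.
  apply: (orbit_of_normal_forms sP Bb Px Bb0 Px0 (octonion_aut_unit A0)).
  apply: stab2_P2; first by apply: AM => //; apply: AV.
  move=> i j j2 /andP[i1 i7]; rewrite ent_mulV_col ?(octonion_aut_unit A2) //.
  - by rewrite gtn_eqF // (leq_trans j2).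
  - exact: leq_trans j2 _.
  move=> k k7; case: j j2 => [|[|]] // _.
    by rewrite (bgx _ k7).1 (bgx0 _ k7).1.
  by rewrite (bgx _ k7).2 (bgx0 _ k7).2.
have sx := P2_stab Px; have x0 := stab2_minor_neq0 sx.
have nz i j : i \in [:: 3; 5; 6]%N -> j \in [:: 3; 5; 6]%N ->
    minor base_point i j != 0 -> minor (b * base_point * x) i j != 0.
  move=> i3 j3 ij; have [_ bi] := A2_borel_row base_point 0 Bb i3.
  have [_ bj] := A2_borel_row base_point 0 Bb j3.
  by rewrite stab2_minor // (A2_borel_minor _ Bb) // !mulf_neq0.
by rewrite !nz.
Qed.

End OpenOrbits.

Theorem theorem7 (R : realType) :
  spherical (G2 R[i]) (P1 R[i]) (A2_long R[i]) /\
  spherical (G2 R[i]) (P2 R[i]) (A2_long R[i]).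
Proof. by split; [apply: G2_P1_spherical | apply: G2_P2_spherical]. Qed.
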